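(* Let $\mu>0$. Consider the one-dimensional DLA process $R(\cdot)$ started with $R(0)=0$ and with $N(i,0)$, $i\ge 1$, i.i.d. Poisson random variables with mean $\mu$. Then $$\limsup_{t\to\infty}\frac{1}{t}R(t)<\infty\quad\text{a.s.}$$ In fact, there exist constants $0<C_1,C_2,C_3<\infty$ such that for all $t\ge 0$ $$P\{R(t)>C_1t\}\le C_2\exp[-C_3t].$$
   Context: One-dimensional DLA process. Fix a jump rate $D>0$. At time $0$ there are $N(i,0)\in\{0,1,2,\dots\}$ particles at each site $i\ge 1$ of $\mathbb{Z}$ (and no other particles), all colored white. All particles perform continuous-time symmetric simple random walks on $\mathbb{Z}$ with jump rate $D$, independent of each other and of the $N(i,0)$. The path of a particle is not influenced by its color. Put $\tau_0=0$ and $R(0)=0$. Inductively, given $\tau_k$ with $R(\tau_k)=k$ and no white particles in $[0,k]$ at time $\tau_k$, let $$\tau_{k+1}=\inf\{t>\tau_k:\text{ some white particle jumps to position }k\text{ at time }t\}$$ (such a jump is necessarily from $k+1$ to $k$). At time $\tau_{k+1}$, all white particles that were at $k+1$ at time $\tau_{k+1}-$ (including the one that jumped) change color to black and stay black forever, and $R$ increases to $k+1$. Black particles have no influence on $R$ or on other particles. Thus $R(t)=k$ for $\tau_k\le t<\tau_{k+1}$. The constants $C_i$ may depend on $\mu$ and $D$ but not on $t$. *)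

(* Defs.v *)
From mathcomp Require Import all_boot all_order all_algebra finmap.
From mathcomp Require Import all_classical all_reals all_analysis.

Set Implicit Arguments.
Unset Strict Implicit.
Unset Printing Implicit Defensive.
Import Order.TTheory GRing.Theory Num.Theory.
Import numFieldNormedType.Exports.
Local Open Scope classical_set_scope.
Local Open Scope ring_scope.

(* [(i, j)] is the [j]-th particle among those starting at site [i.+1]. *)
Definition particle : Type := (nat * nat)%type.

Definition mutually_independent {d} {T : measurableType d} {R : realType}
    (P : probability T R) (I : choiceType) (F : I -> set (set T)) : Prop :=
  forall (K : {fset I}) (A : I -> set T),
    (forall i, i \in K -> F i (A i)) ->
    P (\bigcap_(i in [set` K]) A i) = (\prod_(i <- K) P (A i))%E.

(* The random input: [count i] is N(i+1,0); [hold p n] and [coin p n] are the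
   holding time before, and the direction of, the [n.+1]-st jump of [p].
   A continuous-time simple random walk with jump rate D waits independent
   Exp(D) times between jumps and then jumps by +1 or -1, with probability 1/2
   each.  Walks are attached to every label [p], but only the labels [(i, j)]
   with [j < count i w] are particles of the system. *)
Record dla_input (R : realType) (mu D : R) d (T : measurableType d)
    (P : probability T R) := DlaInput {
  count : nat -> {RV P >-> nat} ;
  hold : particle -> nat -> {RV P >-> R} ;
  coin : particle -> nat -> {RV P >-> bool} ;
  count_law : forall i n,
    P (count i @^-1` [set n]) = (poisson_pmf mu n)%:E ;
  hold_law : forall p n (A : set R), measurable A ->
    distribution P (hold p n) A = exponential_prob D A ;
  coin_law : forall p n (A : set bool),
    distribution P (coin p n) A = bernoulli_prob 2^-1 A ;
  input_indep : mutually_independent P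
    (fun s : (nat + particle * nat + particle * nat)%type =>
       match s with
       | inl (inl i) => preimage_set_system setT (count i) measurable
       | inl (inr (p, n)) => preimage_set_system setT (hold p n) measurable
       | inr (p, n) => preimage_set_system setT (coin p n) measurable
       end)
}.

(* Each path is given by its jump chain: [J p n] is the time of the [n]-th jump
   of [p] (with [J p 0 = 0]) and [Y p n] its position from time [J p n] until
   its next jump. *)
Section dynamics.
Context {R : realType} (J : particle -> nat -> R) (Y : particle -> nat -> int).

Definition jumps_to (p : particle) (x : int) (t : R) : Prop :=
  exists n, J p n.+1 = t /\ Y p n.+1 = x.

(* [p] is at [x] at time [t-]; false for [t = +oo] *)
Definition located_before (p : particle) (x : int) (t : \bar R) : Prop :=
  exists n, ((J p n)%:E < t <= (J p n.+1)%:E)%E /\ Y p n = x.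

(* [dla_stage W0 k] is tau_k together with the set of particles that are white
   just after the colour changes at time tau_k, starting from the white
   particles [W0].  The infimum of the empty set is [+oo]. *)
Fixpoint dla_stage (W0 : set particle) (k : nat) : \bar R * set particle :=
  match k with
  | 0%N => (0%E, W0)
  | k'.+1 =>
    let: (tau, W) := dla_stage W0 k' in
    let tau' := ereal_inf [set t%:E | t in
      [set t : R | (tau < t%:E)%E /\ exists2 p, W p & jumps_to p k'%:Z t]] in
    (tau', W `\` [set p | located_before p (k'.+1)%:Z tau'])
  end.

(* The supremum is [k] when tau_k <= t < tau_(k+1), and it is [+oo] if
   infinitely many tau_k are at most [t]. *)
Definition dla_front (W0 : set particle) (t : R) : \bar R :=
  ereal_sup [set k%:R%:E | k in
    [set k : nat | ((dla_stage W0 k).1 <= t%:E)%E]].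

End dynamics.

Section process.
Context {R : realType} {mu D : R} {d} {T : measurableType d}
  {P : probability T R} (S : dla_input mu D P).

Definition jump_time (w : T) (p : particle) (n : nat) : R :=
  \sum_(k < n) hold S p k w.

Definition jump_chain (w : T) (p : particle) (n : nat) : int :=
  (p.1.+1)%:Z + \sum_(k < n) (if coin S p k w then 1 else -1).

Definition initial_particles (w : T) : set particle :=
  [set p | (p.2 < count S p.1 w)%N].

Definition DLA (w : T) (t : R) : \bar R :=
  dla_front (jump_time w) (jump_chain w) (initial_particles w) t.

End process.

(* Main.v *)
From HB Require Import structures.
From mathcomp Require Import all_boot all_order all_algebra finmap.
From mathcomp Require Import all_classical all_reals all_analysis.
From mathcomp Require Import measurable_realfun.
From mathcomp Require Import ring lra zify.
Require Import Defs.
Set Implicit Arguments.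
Unset Strict Implicit.
Unset Printing Implicit Defensive.
Import Order.TTheory GRing.Theory Num.Theory.
Import numFieldNormedType.Exports.
Local Open Scope classical_set_scope.
Local Open Scope ring_scope.

(** Every advance of the front is caused by the jump of a white particle, and
    that particle turns black at once.  So if the front has reached level [K] by
    time [t], there are [K] distinct particles and times
    [0 < t_0 <= ... <= t_(K-1) <= t] such that the [k]-th of them jumps to site
    [k] at time [t_k] ([front_advance_jumps]).  The colours are then forgotten.
    The initial counts are independent Poisson variables with mean [mu] and the
    particles move independently, so the jumps to a fixed site have intensity at
    most [mu D], and for distinct particles the intensities multiply.  The
    expected number of such families is therefore at most the volume
    [(mu D t)^K / K!] of a simplex, which is exponentially small when [K = C t]
    with [C] large.

    No integration over the simplex is needed: [0, t] is cut into [K] cells of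
    length [l = t / K], a nondecreasing sequence of cells can be chosen in at
    most [4^K] ways, and for one choice the probability that distinct particles
    make the prescribed jumps in the prescribed cells is at most
    [(2 e mu D l)^K] ([prob_crossing_linear]), which leaves
    [(8 e mu D t / K)^K].

    The bound on crossings has three ingredients. A walk started at [i] is at
    [x] after [n] steps with a probability depending on [x - i] only, so
    summing over all [i] leaves only the expected number of jumps of one walk
    in a cell; this is at most [exp (D l) - 1] by the memoryless property
    ([renewal_bound]). Families of distinct particles are encoded by giving
    each particle at most one role, and a weight [z] per role turns the sum
    over all assignments of roles into a product over particles; the
    generating function of the Poisson law then gives [exp (mu z (...))], and
    [z] is optimised ([sum_role_weight_le], [prob_crossing_upto_le]).
    Independence of whole walks comes from that of their holding times and
    coins by the pi-lambda theorem ([joint_sigma_indep]).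

    The analysis of a path needs three properties that hold almost surely
    ([negligible_bad_path]): holding times are positive, no two particles jump
    simultaneously, and few enough particles jump to a site for the infimum that
    defines the next advance to be attained.  The last two follow from the same
    bound on crossings, with two particles on a mesh that is refined, and with
    more and more particles in one cell.  Finally, the limsup is finite by
    Borel-Cantelli along integer times, since the front is monotone in time. *)

(** * Independence of disjoint blocks of random inputs *)

Section grouping.
Context {d} {T : measurableType d} {R : realType} (P : probability T R).
Context (I : choiceType) (F : I -> set (set T)).
Context (indF : mutually_independent P F)
  (sigF : forall i, sigma_algebra setT (F i))
  (measF : forall i A, F i A -> measurable A).

Definition joint_sigma (X : set I) : set (set T) := <<s \bigcup_(i in X) F i >>.

Lemma joint_sigma_sub X Y : X `<=` Y -> joint_sigma X `<=` joint_sigma Y.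
Proof.
move=> XY; apply: smallest_sub; first exact: smallest_sigma_algebra.
by move=> A [i Xi FA]; apply: sub_sigma_algebra; exists i => //; exact: XY.
Qed.

Lemma joint_sigma0 X : joint_sigma X set0.
Proof. by have [] := smallest_sigma_algebra setT (\bigcup_(i in X) F i). Qed.

Lemma joint_sigmaC X A : joint_sigma X A -> joint_sigma X (~` A).
Proof.
have [_ GC _] : sigma_algebra setT (joint_sigma X).
  exact: smallest_sigma_algebra.
by rewrite -setTD; exact: GC.
Qed.

Lemma joint_sigmaT X : joint_sigma X setT.
Proof. by rewrite -setC0; apply: joint_sigmaC; exact: joint_sigma0. Qed.

Lemma joint_sigma_bigcup X (A : nat -> set T) :
  (forall n, joint_sigma X (A n)) -> joint_sigma X (\bigcup_n A n).
Proof.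
have [_ _ GU] : sigma_algebra setT (joint_sigma X).
  exact: smallest_sigma_algebra.
exact: GU.
Qed.

Lemma joint_sigmaU X A B :
  joint_sigma X A -> joint_sigma X B -> joint_sigma X (A `|` B).
Proof.
move=> XA XB; rewrite -bigcup2E; apply: joint_sigma_bigcup => -[|[|n]] //=.
exact: joint_sigma0.
Qed.

Lemma joint_sigmaI X A B :
  joint_sigma X A -> joint_sigma X B -> joint_sigma X (A `&` B).
Proof.
move=> XA XB; rewrite -(setCK (A `&` B)) setCI.
by apply: joint_sigmaC; apply: joint_sigmaU; exact: joint_sigmaC.
Qed.

Lemma joint_sigma_bigcap (B : eqType) (s : seq B) X (E : B -> set T) :
  (forall b, b \in s -> joint_sigma X (E b)) ->
  joint_sigma X (\big[setI/setT]_(b <- s) E b).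
Proof.
move=> XE; rewrite big_seq; elim/big_ind: _ => //; first exact: joint_sigmaT.
exact: joint_sigmaI.
Qed.

(** The pi-system on which mutual independence speaks directly. *)
Definition cylinder (X : set I) : set (set T) :=
  [set C | exists K : {fset I}, exists A : I -> set T,
    [/\ [set` K] `<=` X, forall i, i \in K -> F i (A i)
      & C = \bigcap_(i in [set` K]) A i]].

Let FT i : F i setT.
Proof.
have [F0 FC _] := sigF i.
rewrite -(setD0 setT); exact: FC.
Qed.

Let FI i A B : F i A -> F i B -> F i (A `&` B).
Proof.
move=> FA FB; have [F0 FC FU] := sigF i.
rewrite -(setCK (A `&` B)) setCI -setTD; apply: (FC).
rewrite -bigcup2E; apply: FU => -[|[|n]] //=; rewrite -setTD; exact: FC.
Qed.

Lemma cylinder_setI X : setI_closed (cylinder X).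
Proof.
move=> C C' [K [A [KX FA ->]]] [K' [A' [KX' FA' ->]]].
pose B i := (if i \in K then A i else setT) `&` (if i \in K' then A' i else setT).
exists (K `|` K')%fset, B; split.
- move=> i /=; rewrite in_fsetU => /orP[iK|iK]; [exact: KX|exact: KX'].
- move=> i _; rewrite /B; apply: FI.
    by case: ifP => [/FA|_].
  by case: ifP => [/FA'|_].
- apply/seteqP; split=> w /=.
    move=> [h h'] i _; rewrite /B; split.
      by case: ifP => // iK; exact: h.
    by case: ifP => // iK; exact: h'.
  move=> h; split => i /= iK.
    by have /= := h i; rewrite in_fsetU iK /B iK => /(_ isT)[].
  by have /= := h i; rewrite in_fsetU iK orbT /B iK => /(_ isT)[].
Qed.

Lemma joint_sigmaE X : joint_sigma X = <<s cylinder X >>.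
Proof.
apply/seteqP; split.
  apply: smallest_sub; first exact: smallest_sigma_algebra.
  move=> A [i Xi FA]; apply: sub_sigma_algebra; exists [fset i]%fset, (fun=> A); split.
  - by move=> j /=; rewrite in_fset1 => /eqP ->.
  - by move=> j /=; rewrite in_fset1 => /eqP ->.
  - apply/seteqP; split=> w /= h; first by move=> j _.
    by apply: (h i); rewrite /= in_fset1.
apply: smallest_sub; first exact: smallest_sigma_algebra.
move=> C [K [A [KX FA ->]]].
rewrite bigcap_fset; apply: joint_sigma_bigcap => i iK.
apply: sub_sigma_algebra; by exists i; [exact: KX | exact: FA].
Qed.

Lemma joint_sigma_measurable X A : joint_sigma X A -> measurable A.
Proof.
move: A; apply: smallest_sub; first exact: sigma_algebra_measurable.
by move=> A [i _]; exact: measF.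
Qed.

Lemma cylinder_indep X Y A B : [disjoint X & Y]%classic -> cylinder X A ->
  cylinder Y B ->
  P (A `&` B) = (P A * P B)%E.
Proof.
move=> /disj_setPS XY [K [A' [KX FA ->]]] [K' [B' [KY FB ->]]].
have KK' i : i \in K' -> i \notin K.
  move=> iK'; apply/negP => iK; suff: set0 i by [].
  by apply: XY; split; [exact: KX|exact: KY].
pose C i := if i \in K then A' i else B' i.
have -> : \bigcap_(i in [set` K]) A' i `&` \bigcap_(i in [set` K']) B' i =
          \bigcap_(i in [set` (K `|` K')%fset]) C i.
  apply/seteqP; split=> w /=.
    move=> [h h'] i; rewrite /= in_fsetU /C; case: ifP => iK /= iK'.
      exact: h.
    exact: h'.
  move=> h; split=> i /= iK.
    by have := h i; rewrite /= in_fsetU /C iK => /(_ isT).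
  by have := h i; rewrite /= in_fsetU /C iK orbT (negbTE (KK' _ iK)) => /(_ isT).
rewrite !indF //.
- rewrite (perm_big (enum_fset K ++ enum_fset K')) /=; last first.
    apply: uniq_perm => /=; first exact: fset_uniq.
      rewrite cat_uniq !fset_uniq andbT /=.
      by apply/hasPn => i iK'; exact: KK'.
    by move=> i; rewrite mem_cat in_fsetU.
  rewrite big_cat /=; congr (_ * _)%E.
    by rewrite big_seq [RHS]big_seq; apply: eq_bigr => i; rewrite /C => ->.
  by rewrite big_seq [RHS]big_seq; apply: eq_bigr => i; rewrite /C => /KK'/negbTE ->.
- move=> i; rewrite in_fsetU /C; case: ifP => [iK _|_ /=]; [exact: FA|exact: FB].
Qed.

Lemma indep_lambda (B : set T) : measurable B ->
  lambda_system setT [set A | measurable A /\ P (A `&` B) = (P A * P B)%E].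
Proof.
move=> mB; apply/dynkin_lambda_system; split.
- by split => //; rewrite setTI probability_setT mul1e.
- move=> A [mA PA]; split; first exact: measurableC.
  rewrite probability_setC// setIC -setDE measureD//; last first.
    by rewrite (le_lt_trans (probability_le1 P mB))// ltry.
  transitivity (P B - P A * P B)%E.
    by rewrite -PA setIC.
  rewrite muleBl ?mul1e//.
  by rewrite fin_num_measure.
- move=> A tA AE; split; first by apply: bigcupT_measurable => n; have [] := AE n.
  have mA n : measurable (A n) by have [] := AE n.
  rewrite setI_bigcupl measure_bigcup//; last 2 first.
  - by move=> n _; exact: measurableI.
  - by apply: trivIset_setIr.
  rewrite measure_bigcup// muleC -(fineK (fin_num_measure P _ mB)).
  rewrite -nneseriesZl//.
  by apply: eq_eseriesr => n _; have [_ E] := AE n;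
    rewrite fineK ?fin_num_measure// muleC; exact: E.
Qed.

(** Dynkin's argument on one side at a time: cylinders form a pi-system, and the
    events independent of a fixed event form a lambda-system. *)
Lemma joint_sigma_indep X Y A B : [disjoint X & Y]%classic ->
  joint_sigma X A -> joint_sigma Y B -> P (A `&` B) = (P A * P B)%E.
Proof.
move=> XY XA YB.
have mB := joint_sigma_measurable YB.
have cm Z C : cylinder Z C -> measurable C.
  move=> ZC; apply: (@joint_sigma_measurable Z).
  by rewrite joint_sigmaE; exact: sub_sigma_algebra.
have H : forall C, cylinder X C -> P (B `&` C) = (P B * P C)%E.
  move=> C XC; move: YB; rewrite joint_sigmaE.
  suff : <<s cylinder Y >> `<=`
      [set B0 | measurable B0 /\ P (B0 `&` C) = (P B0 * P C)%E].
    by move=> /[apply] -[].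
  apply: lambda_system_subset => //.
  - exact: cylinder_setI.
  - by apply: indep_lambda; exact: cm XC.
  - move=> D YD; split; first exact: cm YD.
    by rewrite setIC muleC; exact: (cylinder_indep XY).
move: XA; rewrite joint_sigmaE.
suff : <<s cylinder X >> `<=`
    [set A0 | measurable A0 /\ P (A0 `&` B) = (P A0 * P B)%E].
  by move=> /[apply] -[].
apply: lambda_system_subset => //.
- exact: cylinder_setI.
- exact: indep_lambda.
- move=> D XD; split; first exact: cm XD.
  by rewrite setIC H// muleC.
Qed.

Lemma joint_sigma_indep_seq (B : eqType) (s : seq B) (X : B -> set I)
    (E : B -> set T) : uniq s ->
  (forall b c, b \in s -> c \in s -> b != c -> [disjoint X b & X c]%classic) ->
  (forall b, b \in s -> joint_sigma (X b) (E b)) ->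
  P (\big[setI/setT]_(b <- s) E b) = (\prod_(b <- s) P (E b))%E.
Proof.
elim: s => [|b s IH] /=; first by rewrite !big_nil probability_setT.
move=> /andP[bs us] dX XE; rewrite !big_cons.
rewrite (@joint_sigma_indep (X b) (\bigcup_(c in [set` s]) X c)).
- rewrite IH// => [c c' cs c's|c cs]; first by apply: dX; rewrite inE ?cs ?c's orbT.
  by apply: XE; rewrite inE cs orbT.
- apply/disj_setPS => i /= [Xb [c /= cs Xc]].
  have bc : b != c by apply: contraNneq bs => ->.
  have cbs : c \in b :: s by rewrite inE cs orbT.
  by move/disj_setPS : (dX b c (mem_head _ _) cbs bc) => /(_ i (conj Xb Xc)).
- by apply: XE; rewrite inE eqxx.
- apply: joint_sigma_bigcap => c cs.
  apply: (@joint_sigma_sub (X c)); last by apply: XE; rewrite inE cs orbT.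
  by move=> i Xi; exists c.
Qed.

(** A copy of the sample space on which measurability of a function means
    measurability with respect to the block [X]. *)
Definition joint_type (X : set I) := g_sigma_algebraType (\bigcup_(i in X) F i).

(** Joint law and product of the marginals agree on rectangles. *)
Lemma indep_pair_law d1 d2 (T1 : measurableType d1) (T2 : measurableType d2)
    (X Y : set I) (f : {RV P >-> T1}) (g : {RV P >-> T2}) :
  [disjoint X & Y]%classic ->
  (forall A, measurable A -> joint_sigma X (f @^-1` A)) ->
  (forall A, measurable A -> joint_sigma Y (g @^-1` A)) ->
  forall A, measurable A ->
  P [set w | A (f w, g w)] = (distribution P f \x distribution P g)%E A.
Proof.
move=> XY mf mg A mA.
have mfg : measurable_fun setT (fun w => (f w, g w)).
  exact: measurable_fun_pair.
pose fg : {mfun T >-> (T1 * T2)%type} :=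
  HB.pack (fun w => (f w, g w)) (isMeasurableFun.Build _ _ _ _ _ mfg).
apply/esym; apply: (@product_measure_unique _ _ _ _ _ (distribution P f)
  (distribution P g)
  (distribution P fg)) => //.
move=> B C mB mC; rewrite /distribution /pushforward.
rewrite -(@joint_sigma_indep X Y) //; [exact: mf|exact: mg].
Qed.

End grouping.

(** * Probabilities as real numbers, measurability *)

Section probability_facts.
Context {d} {T : measurableType d} {R : realType} (P : probability T R).
Implicit Types A B : set T.

(** Real-valued, so that sums and products of probabilities can be handled by
    field arithmetic. *)
Definition prob A : R := fine (P A).

Lemma probE A : measurable A -> P A = (prob A)%:E.
Proof. by move=> mA; rewrite fineK// fin_num_measure. Qed.

Lemma prob_ge0 A : 0 <= prob A.
Proof. exact: fine_ge0. Qed.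

Lemma prob_le1 A : measurable A -> prob A <= 1.
Proof. by move=> mA; rewrite -lee_fin -probE// probability_le1. Qed.

Lemma le_prob A B : measurable A -> measurable B -> A `<=` B -> prob A <= prob B.
Proof. by move=> mA mB AB; rewrite -lee_fin -!probE// le_measure// inE. Qed.

Lemma probU A B : measurable A -> measurable B -> prob (A `|` B) <= prob A + prob B.
Proof.
move=> mA mB; rewrite -lee_fin EFinD -!probE//; last exact: measurableU.
exact: measureU2.
Qed.

Lemma prob_setU A B : measurable A -> measurable B -> [disjoint A & B]%classic ->
  prob (A `|` B) = prob A + prob B.
Proof.
move=> mA mB /disj_set2P AB; apply: EFin_inj; rewrite EFinD -!probE//;
  last exact: measurableU.
exact: measureU.
Qed.

Lemma prob_setC A : measurable A -> prob (~` A) = 1 - prob A.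
Proof.
move=> mA; apply: EFin_inj; rewrite EFinB -!probE//; last exact: measurableC.
exact: probability_setC.
Qed.

Lemma prob_bigcup_le (F : nat -> set T) (b : R) :
  (forall n, measurable (F n)) -> nondecreasing_seq F ->
  (forall n, prob (F n) <= b) -> prob (\bigcup_n F n) <= b.
Proof.
move=> mF ndF Fb.
have mU : measurable (\bigcup_n F n) by exact: bigcupT_measurable.
rewrite -lee_fin -probE//.
have /cvg_lim <- // := nondecreasing_cvg_mu (mu := P) mF mU ndF.
apply: lime_le.
  by apply: cvgP (nondecreasing_cvg_mu (mu := P) mF mU ndF).
by apply: nearW => n; rewrite /= probE// lee_fin.
Qed.

Lemma prob_bigsetU (I : Type) (s : seq I) (Q : pred I) (E : I -> set T) :
  (forall i, measurable (E i)) ->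
  prob (\big[setU/set0]_(i <- s | Q i) E i) <= \sum_(i <- s | Q i) prob (E i).
Proof.
move=> mE; elim: s => [|i s IH]; first by rewrite !big_nil /prob measure0.
rewrite !big_cons; case: ifP => // Qi; apply: (le_trans (probU _ _)) => //.
  exact: bigsetU_measurable.
by rewrite lerD2l.
Qed.

Lemma negligible_prob A : measurable A -> prob A <= 0 -> P.-negligible A.
Proof.
move=> mA A0; exists A; split => //.
by apply/eqP; rewrite probE// eqe eq_le A0 prob_ge0.
Qed.

End probability_facts.

Section measurable_quantifiers.
Context {d} {T : measurableType d}.

Lemma measurable_exists (I : countType) (Q : I -> T -> Prop) :
  (forall i, measurable [set w | Q i w]) -> measurable [set w | exists i, Q i w].
Proof.
move=> mQ; rewrite (_ : [set w | _] = \bigcup_i [set w | Q i w]).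
  by apply: countable_bigcupT_measurable => //; exact: countableP.
by apply/seteqP; split=> w /= [i]; [move=> Qi; exists i|move=> _ Qi; exists i].
Qed.

Lemma measurable_forall (I : countType) (Q : I -> T -> Prop) :
  (forall i, measurable [set w | Q i w]) -> measurable [set w | forall i, Q i w].
Proof.
move=> mQ; rewrite (_ : [set w | _] = ~` [set w | exists i, ~ Q i w]).
  by apply: measurableC; apply: measurable_exists => i; exact: (measurableC (mQ i)).
apply/seteqP; split=> w /=; first by move=> h [i]; apply.
by move=> h i; apply: contrapT => hi; apply: h; exists i.
Qed.

Lemma measurable_and (Q1 Q2 : T -> Prop) :
  measurable [set w | Q1 w] -> measurable [set w | Q2 w] ->
  measurable [set w | Q1 w /\ Q2 w].
Proof. exact: measurableI. Qed.

Lemma measurable_const (Q : Prop) : measurable [set w : T | Q].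
Proof.
have [q|q] := pselect Q.
  by rewrite (_ : [set w | _] = setT)//; apply/seteqP; split.
by rewrite (_ : [set w | _] = set0)//; apply/seteqP; split.
Qed.

End measurable_quantifiers.

Section exponential_law.
Context {R : realType} (D : R) (D_gt0 : 0 < D).
Local Notation nu := (exponential_prob D).

Let mpdf : measurable_fun [set: R] (EFin \o exponential_pdf D).
Proof. by apply/measurable_EFinP; exact: measurable_exponential_pdf. Qed.

Lemma exponential_prob_le0 : nu `]-oo, 0] = 0%E.
Proof.
rewrite /exponential_prob -integral_itv_bndo_bndc; last exact: measurable_funTS.
apply: integral0_eq => x /=; rewrite in_itv/= => x0.
by rewrite lt0_exponential_pdf.
Qed.

Lemma exponential_prob_0c x : 0 <= x -> nu `]-oo, x] = (1 - expR (- D * x))%:E.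
Proof.
rewrite le_eqVlt => /predU1P[<-|x0].
  by rewrite exponential_prob_le0 mulr0 expR0 subrr.
rewrite EFinB -exponential_prob_itv0c// /exponential_prob.
rewrite (@itv_bndbnd_setU _ _ _ (BRight 0)) ?bnd_simp ?(ltW x0)//.
rewrite ge0_integral_setU//=.
- have := exponential_prob_le0; rewrite /exponential_prob => ->; rewrite add0e.
  by rewrite integral_itv_obnd_cbnd//; exact: measurable_funTS.
- exact: measurable_funTS.
- by move=> y _; rewrite lee_fin exponential_pdf_ge0// ltW.
- apply/disj_set2P; rewrite -subset0 => y [] /=; rewrite !in_itv/= => y0 /andP[].
  by rewrite ltNge y0.
Qed.

End exponential_law.

(** * The random walks *)

Section walk.
Context {R : realType} {mu D : R} {d} {T : measurableType d}
  {P : probability T R} (S : dla_input mu D P).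

(** The index type of the independent family of inputs: a count, a holding time
    or a coin. *)
Definition input_index : Type := (nat + particle * nat + particle * nat)%type.

Definition input_sigma (s : input_index) : set (set T) :=
  match s with
  | inl (inl i) => preimage_set_system setT (count S i) measurable
  | inl (inr (p, n)) => preimage_set_system setT (hold S p n) measurable
  | inr (p, n) => preimage_set_system setT (coin S p n) measurable
  end.

Local Notation sigma_of := (joint_sigma input_sigma).

Lemma input_sigma_algebra s : sigma_algebra setT (input_sigma s).
Proof.
by case: s => [[i|[p n]]|[p n]]; apply: sigma_algebra_preimage;
  exact: sigma_algebra_measurable.
Qed.

Lemma input_sigma_measurable s A : input_sigma s A -> measurable A.
Proof.
by case: s => [[i|[p n]]|[p n]] [B mB <-];
   exact: measurable_funP.
Qed.

Lemma input_mutually_independent : mutually_independent P input_sigma.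
Proof. exact: (@input_indep _ _ _ _ _ _ S). Qed.

Lemma input_block_indep X Y A B : [disjoint X & Y]%classic ->
  sigma_of X A -> sigma_of Y B -> prob P (A `&` B) = prob P A * prob P B.
Proof.
move=> XY XA YB.
have mA := joint_sigma_measurable input_sigma_measurable XA.
have mB := joint_sigma_measurable input_sigma_measurable YB.
apply: EFin_inj; rewrite EFinM -!probE//; last exact: measurableI.
exact: (joint_sigma_indep input_mutually_independent input_sigma_algebra
  input_sigma_measurable XY).
Qed.

Definition hold_indices (p : particle) (n : nat) : set input_index :=
  [set (inl (inr (p, m)) : input_index) | m in `I_n].
Definition coin_indices (p : particle) (n : nat) : set input_index :=
  [set (inr (p, m) : input_index) | m in `I_n].

Lemma sigma_of_hold p n (A : set R) : measurable A ->
  sigma_of [set inl (inr (p, n))] (hold S p n @^-1` A).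
Proof.
move=> mA; apply: sub_sigma_algebra; exists (inl (inr (p, n))) => //=.
by exists A => //; rewrite setTI.
Qed.

Lemma sigma_of_coin p n (A : set bool) :
  sigma_of [set inr (p, n)] (coin S p n @^-1` A).
Proof.
apply: sub_sigma_algebra; exists (inr (p, n)) => //=.
by exists A => //; rewrite setTI.
Qed.

Lemma sigma_of_count i (A : set nat) :
  sigma_of [set inl (inl i)] (count S i @^-1` A).
Proof.
apply: sub_sigma_algebra; exists (inl (inl i)) => //=.
by exists A => //; rewrite setTI.
Qed.

Lemma sigma_of_jump_time p n (A : set R) : measurable A ->
  sigma_of (hold_indices p n) ((fun w => jump_time S w p n) @^-1` A).
Proof.
move=> mA.
have mf : measurable_fun (setT : set (joint_type input_sigma (hold_indices p n)))
    (fun w => jump_time S w p n).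
  apply: measurable_sum => k _ B mB; rewrite setTI.
  apply: (@joint_sigma_sub _ _ _ _ [set inl (inr (p, nat_of_ord k))]).
    by move=> i /= ->; exists k => //=.
  exact: sigma_of_hold.
by have := mf measurableT _ mA; rewrite setTI.
Qed.

Definition displacement w p n : int := \sum_(k < n) (if coin S p k w then 1 else -1).

Lemma displacementS p n z : [set w | displacement w p n.+1 = z] =
   ((coin S p n @^-1` [set true]) `&` [set w | displacement w p n = z - 1]) `|`
   ((coin S p n @^-1` [set false]) `&` [set w | displacement w p n = z + 1]).
Proof.
apply/seteqP; split=> w /=; rewrite /displacement big_ord_recr /=;
  set s := \sum_(_ < _) _.
  case: (coin S p n w) => /= <-.
    by left; rewrite addrK.
  by right; rewrite subrK.
by case: (coin S p n w) => -[[]|[]] // _ -> /=; rewrite ?addrK ?subrK.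
Qed.

Lemma sigma_of_displacement p n z : sigma_of (coin_indices p n)
  [set w | displacement w p n = z].
Proof.
elim: n z => [|n IH] z.
  have -> : [set w | displacement w p 0 = z] = if z == 0 then setT else set0.
    apply/seteqP; split=> w /=; rewrite /displacement big_ord0.
      by move=> <-; rewrite eqxx.
    by case: eqP => [->|].
  by case: ifP => _; [exact: joint_sigmaT|exact: joint_sigma0].
rewrite displacementS.
have sub1 : sigma_of (coin_indices p n) `<=` sigma_of (coin_indices p n.+1).
  apply: joint_sigma_sub => _ [m /= mn <-]; exists m => //=.
  by rewrite ltnS ltnW.
have sub2 : sigma_of [set inr (p, n)] `<=` sigma_of (coin_indices p n.+1).
  by apply: joint_sigma_sub => _ ->; exists n => /=.
apply: joint_sigmaU; apply: joint_sigmaI.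
- by apply: sub2; exact: sigma_of_coin.
- by apply: sub1; exact: IH.
- by apply: sub2; exact: sigma_of_coin.
- by apply: sub1; exact: IH.
Qed.

End walk.

Arguments input_block_indep {R mu D d T P} S {X Y A B}.
Arguments input_sigma_measurable {R mu D d T P} S s {A}.
Arguments sigma_of_jump_time {R mu D d T P} S p n {A}.
Arguments sigma_of_hold {R mu D d T P} S p n {A}.
Arguments sigma_of_coin {R mu D d T P} S p n A.
Arguments sigma_of_count {R mu D d T P} S i A.
Arguments sigma_of_displacement {R mu D d T P} S p n z.
Arguments input_mutually_independent {R mu D d T P} S K A.
Arguments input_sigma_algebra {R mu D d T P} S s.

(** Law of the simple symmetric walk, by conditioning on the last step. *)
Fixpoint walk_law {R : realType} (n : nat) (z : int) : R :=
  if n is m.+1 then 2^-1 * walk_law m (z - 1) + 2^-1 * walk_law m (z + 1)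
  else (z == 0)%:R.

Lemma walk_law_ge0 {R : realType} n z : 0 <= walk_law n z :> R.
Proof.
elim: n z => [|n IH] z /=; first by rewrite ler0n.
by rewrite addr_ge0// mulr_ge0// invr_ge0.
Qed.

(** Each step averages two translates of the law, so the bound is inherited from
    the point mass. *)
Lemma sum_walk_law_le1 {R : realType} n (x : int) L :
  \sum_(i < L) walk_law n (x - i%:Z) <= 1 :> R.
Proof.
elim: n x => [|n IH] x /=.
  elim: L => [|L IH]; first by rewrite big_ord0.
  rewrite big_ord_recr /=; case: (eqVneq (x - L%:Z) 0) => [xL|_]; last by rewrite addr0.
  rewrite big1 ?add0r// => i _.
  have := ltn_ord i; case: eqP => // xi; lia.
rewrite big_split /= -!mulr_sumr.
have H1 := IH (x - 1); have H2 := IH (x + 1).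
rewrite (eq_bigr (fun i : 'I_L => walk_law n (x - 1 - i%:Z))); last first.
  by move=> i _; congr walk_law; lia.
rewrite [X in _ + _ * X](eq_bigr (fun i : 'I_L => walk_law n (x + 1 - i%:Z)));
  last first.
  by move=> i _; congr walk_law; lia.
lra.
Qed.

Section walk_law.
Context {R : realType} {mu D : R} {d} {T : measurableType d}
  {P : probability T R} (D_gt0 : 0 < D) (S : dla_input mu D P).

Lemma prob_coin p n b : prob P (coin S p n @^-1` [set b]) = 2^-1.
Proof.
have := coin_law S p n [set b]; rewrite /distribution /pushforward /= => E.
rewrite /prob; apply: EFin_inj; rewrite fineK; last first.
  by apply: fin_num_measure; rewrite -[X in measurable X]setTI; exact: measurable_funP.
rewrite [LHS]E bernoulli_probE; last by apply/andP; split; lra.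
rewrite !diracE.
rewrite !classical_sets.in_set1 -!EFinM -EFinD; congr EFin.
by case: b {E} => /=; rewrite /unstable.onem; lra.
Qed.

Lemma prob_displacement p n z :
  prob P [set w | displacement S w p n = z] = walk_law n z.
Proof.
elim: n z => [|n IH] z /=.
  case: (eqVneq z 0) => [->|z0].
    rewrite (_ : [set w | _] = setT); first by rewrite /prob probability_setT.
    by apply/seteqP; split=> w //= _; rewrite /displacement big_ord0.
  rewrite (_ : [set w | _] = set0); first by rewrite /prob measure0.
  by apply/seteqP; split=> w //=; rewrite /displacement big_ord0 => /esym/eqP;
    rewrite (negbTE z0).
have sigma_of_meas X A (H : joint_sigma (input_sigma S) X A) : measurable A.
  exact: (joint_sigma_measurable (input_sigma_measurable S) H).
rewrite displacementS prob_setU; first last.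
- by apply/disj_set2P; rewrite -subset0 => w /= [[-> _] []].
- by apply: measurableI; apply: sigma_of_meas;
    [exact: sigma_of_coin|exact: sigma_of_displacement].
- by apply: measurableI; apply: sigma_of_meas;
    [exact: sigma_of_coin|exact: sigma_of_displacement].
have dis : [disjoint [set (inr (p, n) : input_index)] & coin_indices p n]%classic.
  by apply/disj_set2P; rewrite -subset0 => i [/= -> [m /= mn [mE]]];
    rewrite mE ltnn in mn.
by congr (_ + _); rewrite (input_block_indep S dis) ?prob_coin ?IH//;
  by [exact: sigma_of_coin|exact: sigma_of_displacement].
Qed.

Lemma prob_hold_le0 p n : prob P [set w | hold S p n w <= 0] = 0.
Proof.
rewrite /prob (_ : [set w | _] = hold S p n @^-1` `]-oo, 0]); last first.
  by apply/seteqP; split=> w /=; rewrite in_itv.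
have := hold_law S p n (measurable_itv `]-oo, (0:R)]).
by rewrite /distribution /pushforward /= => ->; rewrite exponential_prob_le0.
Qed.

Lemma prob_hold_le p n x : 0 <= x ->
  prob P [set w | hold S p n w <= x] = 1 - expR (- D * x).
Proof.
move=> x0.
rewrite /prob (_ : [set w | _] = hold S p n @^-1` `]-oo, x]); last first.
  by apply/seteqP; split=> w /=; rewrite in_itv.
have := hold_law S p n (measurable_itv `]-oo, x]).
by rewrite /distribution /pushforward /= => ->; rewrite exponential_prob_0c.
Qed.
End walk_law.

(** * The expected number of jumps in a time interval *)

Section renewal.
Context {R : realType} {mu D : R} {d} {T : measurableType d}
  {P : probability T R} (D_gt0 : 0 < D) (S : dla_input mu D P).

Lemma measurable_jump_time p n : measurable_fun setT (fun w => jump_time S w p n).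
Proof.
move=> _ A mA; rewrite setTI.
exact: (joint_sigma_measurable (input_sigma_measurable S) (sigma_of_jump_time S
  p n mA)).
Qed.

Definition jump_time_rv p n : {RV P >-> R} :=
  HB.pack (fun w => jump_time S w p n) (isMeasurableFun.Build _ _ _ _ _
    (@measurable_jump_time p n)).

Lemma jump_timeS w p n : jump_time S w p n.+1 = jump_time S w p n + hold S p n w.
Proof. by rewrite /jump_time big_ord_recr. Qed.

Lemma jump_time0 w p : jump_time S w p 0 = 0.
Proof. by rewrite /jump_time big_ord0. Qed.

Lemma jump_hold_law p n A : measurable A ->
  P [set w | A (jump_time S w p n, hold S p n w)] =
  (distribution P (jump_time_rv p n) \x distribution P (hold S p n))%E A.
Proof.
move=> mA.
have dis : [disjoint hold_indices p n & [set (inl (inr (p, n)) : input_index)]]%classic.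
  by apply/disj_set2P; rewrite -subset0 => i [[m /= mn <-] [mE]]; rewrite mE ltnn in mn.
apply: (indep_pair_law (input_mutually_independent S) (input_sigma_algebra S)
  (input_sigma_measurable S) (f := jump_time_rv p n) dis _ _ mA).
- by move=> B mB; exact: sigma_of_jump_time.
- by move=> B mB; exact: sigma_of_hold.
Qed.

(** Sums over starting sites can only be carried out because jump times have the
    same law for all labels. *)
Lemma jump_time_law p q n (A : set R) : measurable A ->
  prob P [set w | A (jump_time S w p n)] =
  prob P [set w | A (jump_time S w q n)].
Proof.
suff H : forall A, measurable A ->
  distribution P (jump_time_rv p n) A = distribution P (jump_time_rv q n) A.
  by move=> mA; rewrite /prob; congr fine; exact: H.
elim: n => [|n IH] B mB.
  rewrite /distribution /pushforward /=; congr (P _).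
  by apply/seteqP; split=> w /=; rewrite !jump_time0.
have mB2 : measurable ((fun z : R * R => z.1 + z.2) @^-1` B).
  by rewrite -[X in measurable X]setTI; apply: measurable_funD.
have E r : distribution P (jump_time_rv r n.+1) B =
   P [set w | ((fun z : R * R => z.1 + z.2) @^-1` B) (jump_time S w r n, hold S r n w)].
  by rewrite /distribution /pushforward /=; congr (P _); apply/seteqP;
    split=> w /=; rewrite jump_timeS.
rewrite !E !jump_hold_law//.
apply: (product_measure_unique (m' :=
  (distribution P (jump_time_rv q n) \x distribution P (hold S q n))%E)) => //.
move=> B1 B2 mB1 mB2'; rewrite /= product_measure1E// IH//.
congr (_ * _)%E.
by transitivity (distribution P (hold S q n) B2) => //; rewrite !hold_law.
Qed.

Lemma hold_itv_law p n u v : 0 <= u -> u <= v ->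
  distribution P (hold S p n) `]u, v] = (expR (- D * u) - expR (- D * v))%:E.
Proof.
move=> u0 uv; have mh A : measurable A -> measurable (hold S p n @^-1` A).
  by move=> mA; rewrite -[X in measurable X]setTI; exact: measurable_funP.
rewrite /distribution /pushforward probE; last exact: mh.
congr EFin; have v0 := le_trans u0 uv.
have := prob_hold_le D_gt0 S p n v0.
rewrite (_ : [set w | hold S p n w <= v] =
  [set w | hold S p n w <= u] `|` (hold S p n @^-1` `]u, v])); last first.
  apply/seteqP; split=> w /=; rewrite in_itv/=.
    by move=> ->; case: (leP (hold S p n w) u) => h; [left|right].
  by case=> [h|/andP[]//]; exact: le_trans h uv.
rewrite prob_setU ?prob_hold_le//; first lra.
- exact: (mh _ (measurable_itv `]-oo, u])).
- exact: mh.
- apply/disj_set2P; rewrite -subset0 => w /= [h]; rewrite in_itv/= => /andP[].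
  by rewrite ltNge h.
Qed.

Lemma hold_gt_law p n u : 0 <= u ->
  distribution P (hold S p n) `]u, +oo[ = (expR (- D * u))%:E.
Proof.
move=> u0; have mh A : measurable A -> measurable (hold S p n @^-1` A).
  by move=> mA; rewrite -[X in measurable X]setTI; exact: measurable_funP.
have := prob_hold_le D_gt0 S p n u0.
rewrite (_ : [set w | hold S p n w <= u] = ~` (hold S p n @^-1` `]u, +oo[)); last first.
  by apply/seteqP; split=> w /=; rewrite in_itv/= andbT leNgt => /negP.
rewrite prob_setC; last exact: mh.
move=> h; rewrite /distribution /pushforward probE; last exact: mh.
by congr EFin; lra.
Qed.

(** The memoryless property at a random time: given that the [n]-th jump occurs
    at [x <= a] and the next one after [a], the overshoot of [a] is again
    exponential. *)
Lemma jump_memoryless p n a l : 0 <= l ->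
  prob P [set w | jump_time S w p n <= a /\ a < jump_time S w p n.+1 <= a + l] =
  (1 - expR (- D * l)) *
  prob P [set w | jump_time S w p n <= a /\ a < jump_time S w p n.+1].
Proof.
move=> l0.
pose A1 := [set z : R * R | z.1 <= a] `&` [set z : R * R | a < z.1 + z.2 <= a + l].
pose A2 := [set z : R * R | z.1 <= a] `&` [set z : R * R | a < z.1 + z.2].
have mfst (B : set R) : measurable B -> measurable [set z : R * R | B z.1].
  by move=> mB; rewrite -[X in measurable X]setTI; exact: measurable_fst.
have madd (B : set R) : measurable B -> measurable [set z : R * R | B (z.1 + z.2)].
  by move=> mB; rewrite -[X in measurable X]setTI; apply: measurable_funD.
have mle : measurable [set z : R * R | z.1 <= a].
  exact: (mfst _ (measurable_itv `]-oo, a])).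
have mA1 : measurable A1.
  apply: measurableI => //.
  exact: (madd _ (measurable_itv `]a, a + l])).
have mA2 : measurable A2.
  apply: measurableI => //.
  have := madd _ (measurable_itv `]a, +oo[); congr measurable.
  by apply/seteqP; split=> z /=; rewrite in_itv/= andbT.
have rho0 : 0 <= 1 - expR (- D * l).
  by rewrite subr_ge0 -expR0 ler_expR mulNr oppr_le0 mulr_ge0// ltW.
rewrite /prob (_ : [set w | _] =
  [set w | A1 (jump_time S w p n, hold S p n w)]); last first.
  by apply/seteqP; split=> w /=; rewrite /A1 /= jump_timeS.
rewrite (_ : [set w | _ /\ _] =
  [set w | A2 (jump_time S w p n, hold S p n w)]); last first.
  by apply/seteqP; split=> w /=; rewrite /A2 /= jump_timeS.
have fA2 : P [set w | A2 (jump_time S w p n, hold S p n w)] \is a fin_num.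
  rewrite ge0_fin_numE//; apply: (le_lt_trans (probability_le1 P _));
    last by rewrite ltry.
  rewrite (_ : [set w | _] = (fun w => jump_time S w p n) @^-1` `]-oo, a] `&`
      (fun w => jump_time S w p n.+1) @^-1` `]a, +oo[).
    by apply: measurableI; rewrite -[X in measurable X]setTI;
      exact: measurable_jump_time.
  by apply/seteqP; split=> w /=; rewrite /A2 /= jump_timeS !in_itv/= andbT.
rewrite jump_hold_law// in fA2 *.
rewrite jump_hold_law// -[RHS]/((fine (1 - expR (- D * l))%:E) * _) -fineM//.
congr fine.
rewrite /product_measure1 -ge0_integralZl//; last exact: measurable_fun_xsection.
apply: eq_integral => x _ /=.
have [xa|xa] := leP x a; last first.
  have x0 : xsection A1 x = set0.
    by apply/seteqP; split=> y //; rewrite /xsection/= inE /A1 /= => -[];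
      rewrite leNgt xa.
  have x0' : xsection A2 x = set0.
    by apply/seteqP; split=> y //; rewrite /xsection/= inE /A2 /= => -[];
      rewrite leNgt xa.
  by rewrite /= x0 x0' !measure0 mule0.
have -> : xsection A1 x = `]a - x, a + l - x]%classic.
  apply/seteqP; split=> y; rewrite /xsection/= inE /A1 /= in_itv/= ltrBlDl lerBrDl.
    by case.
  by [].
have -> : xsection A2 x = `]a - x, +oo[%classic.
  apply/seteqP; split=> y; rewrite /xsection/= inE /A2 /= in_itv/= ltrBlDl andbT.
    by case.
  by [].
rewrite [LHS]hold_itv_law ?subr_ge0//; last lra.
rewrite [X in (_ = _ * X)%E]hold_gt_law ?subr_ge0// -EFinM; congr EFin.
rewrite mulrBl mul1r -expRD; congr (_ - expR _); lra.
Qed.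
Lemma measurable_jump_time_set p n (A : set R) : measurable A ->
  measurable [set w | A (jump_time S w p n)].
Proof.
by move=> mA; rewrite -[X in measurable X]setTI; exact: measurable_jump_time.
Qed.

Lemma measurable_jump_time_le p n a : measurable [set w | jump_time S w p n <= a].
Proof. exact: (measurable_jump_time_set p n (measurable_itv `]-oo, a])). Qed.

Lemma measurable_jump_time_gt p n a : measurable [set w | a < jump_time S w p n].
Proof.
have := measurable_jump_time_set p n (measurable_itv `]a, +oo[).
congr measurable.
by apply/seteqP; split=> w /=; rewrite in_itv/= andbT.
Qed.

Lemma measurable_jump_time_itv p n a b : measurable
  [set w | a < jump_time S w p n <= b].
Proof. exact: (measurable_jump_time_set p n (measurable_itv `]a, b])). Qed.

Lemma measurable_hold_set p n (A : set R) : measurable A ->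
  measurable [set w | A (hold S p n w)].
Proof.
by move=> mA; rewrite -[X in measurable X]setTI; exact: measurable_funP.
Qed.

Lemma measurable_hold_le p n a : measurable [set w | hold S p n w <= a].
Proof. exact: (measurable_hold_set p n (measurable_itv `]-oo, a])). Qed.

Lemma jump_hold_indep p n (A B : set R) : measurable A -> measurable B ->
  prob P ([set w | A (jump_time S w p n)] `&` [set w | B (hold S p n w)]) =
  prob P [set w | A (jump_time S w p n)] * prob P [set w | B (hold S p n w)].
Proof.
move=> mA mB.
have dis : [disjoint hold_indices p n & [set (inl (inr (p, n)) : input_index)]]%classic.
  by apply/disj_set2P; rewrite -subset0 => i [[m /= mn <-] [mE]]; rewrite mE ltnn in mn.
exact: (input_block_indep S dis (sigma_of_jump_time S p n mA) (sigma_of_hold S p n mB)).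
Qed.

(** A jump in the interval is either the first one there, after a jump before
    [a], or it follows another jump in the interval by at most [l].  Both cost a
    factor [c = 1 - exp (- D l)], the former by [jump_memoryless], so the
    expected number [U] of jumps satisfies [U <= c (1 + U)]. *)
Lemma renewal_bound p a l N : 0 <= a -> 0 <= l ->
  \sum_(n < N) prob P [set w | a < jump_time S w p n.+1 <= a + l]
  <= expR (D * l) - 1.
Proof.
move=> a0 l0.
set c := 1 - expR (- D * l).
pose u n := prob P [set w | a < jump_time S w p n <= a + l].
pose v n := prob P [set w | jump_time S w p n <= a /\ a < jump_time S w p n.+1].
pose s n := prob P [set w | jump_time S w p n <= a].
have e0 : 0 < expR (- D * l) by exact: expR_gt0.
have c0 : 0 <= c.
  by rewrite subr_ge0 -expR0 ler_expR mulNr oppr_le0 mulr_ge0// ltW.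
have u0 : u 0%N = 0.
  rewrite /u (_ : [set w | _] = set0) ?/prob ?measure0//.
  by apply/seteqP; split=> w //=; rewrite jump_time0 ltNge a0.
have mv n : measurable [set w | jump_time S w p n <= a /\ a < jump_time S w p n.+1].
  exact: (measurableI _ _ (measurable_jump_time_le p n a)
    (measurable_jump_time_gt p n.+1 a)).
have uS n : u n.+1 <= c * v n + u n * c.
  have -> : c * v n = prob P
    [set w | jump_time S w p n <= a /\ a < jump_time S w p n.+1 <= a + l].
    by rewrite jump_memoryless.
  have -> : u n * c = prob P ([set w | a < jump_time S w p n
    <= a + l] `&` [set w | hold S p n w <= l]).
    rewrite (jump_hold_indep p n (measurable_itv `]a,
      a + l]) (measurable_itv `]-oo, l])).
    by congr (_ * _); exact: (esym (prob_hold_le D_gt0 S p n l0)).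
  have m1 : measurable [set w | jump_time S w p n
    <= a /\ a < jump_time S w p n.+1 <= a + l].
    exact: (measurableI _ _ (measurable_jump_time_le p n a)
      (measurable_jump_time_itv p n.+1 _ _)).
  have m2 : measurable ([set w | a < jump_time S w p n <= a + l] `&`
    [set w | hold S p n w <= l]).
    exact: (measurableI _ _ (measurable_jump_time_itv p n _ _)
      (measurable_hold_le p n l)).
  have m3 := measurable_hold_le p n 0.
  rewrite -[leRHS]addr0 -(prob_hold_le0 S p n).
  apply: le_trans (_ : prob P (([set w | jump_time S w p n
    <= a /\ a < jump_time S w p n.+1 <= a + l] `|`
    ([set w | a < jump_time S w p n <= a + l] `&` [set w | hold S p n w <= l])) `|`
     [set w | hold S p n w <= 0]) <= _).
    apply: le_prob.
    - exact: measurable_jump_time_itv.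
    - by apply: measurableU => //; exact: measurableU.
    - move=> w /=; rewrite jump_timeS => /andP[h1 h2].
      have [h0|h0] := leP (hold S p n w) 0; first by right.
      left; have [ja|ja] := leP (jump_time S w p n) a; [left|right].
        by rewrite h1 h2.
      by split; [apply/andP; split; lra|lra].
  apply: (le_trans (probU _ _ m3)); first exact: measurableU.
  by rewrite lerD2r; exact: probU.
(* Jump times almost surely do not decrease, so [v] telescopes. *)
have vs n : v n <= s n - s n.+1.
  have m3 := measurable_hold_le p n 0.
  have H1 : s n = v n + prob P ([set w | jump_time S w p n <= a] `&`
    [set w | jump_time S w p n.+1 <= a]).
    rewrite -prob_setU//.
    - congr (prob P _); apply/seteqP; split=> w /=; last by case=> [[]|[]].
      by move=> h; have [j|j] := leP (jump_time S w p n.+1) a; [right|left].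
    - by apply: measurableI; exact: measurable_jump_time_le.
    - apply/disj_set2P; rewrite -subset0 => w /= [[_ h] [_]].
      by rewrite leNgt h.
  have H2 : s n.+1 <= prob P ([set w | jump_time S w p n <= a] `&`
    [set w | jump_time S w p n.+1 <= a]) + 0.
    rewrite -(prob_hold_le0 S p n); apply: (le_trans _ (probU _ _ m3)).
      apply: le_prob.
      - exact: measurable_jump_time_le.
      - apply: measurableU => //; apply: measurableI; exact: measurable_jump_time_le.
      - move=> w /=; rewrite jump_timeS => h.
        by have [h0|h0] := leP (hold S p n w) 0; [right|left; split; lra].
    by apply: measurableI; exact: measurable_jump_time_le.
  lra.
have sumv : \sum_(n < N) v n <= 1.
  apply: le_trans (_ : s 0%N - s N <= _); last first.
    have : s 0%N <= 1 by apply: prob_le1; exact: measurable_jump_time_le.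
    have : 0 <= s N by exact: prob_ge0.
    lra.
  elim: N => [|N IH]; first by rewrite big_ord0 subrr.
  by rewrite big_ord_recr /=; have := vs N; lra.
set U := \sum_(n < N) _.
have U2 : \sum_(n < N) u n <= U.
  case: N @U {sumv} => [|N] U; first by rewrite /U !big_ord0.
  rewrite big_ord_recl u0 add0r /U [leRHS]big_ord_recr /=.
  by rewrite lerDl; exact: prob_ge0.
have UE : U <= c * (\sum_(n < N) v n) + (\sum_(n < N) u n) * c.
  by rewrite mulr_sumr mulr_suml -big_split /=; apply: ler_sum => n _; exact: uS.
have Uc : U <= c * 1 + U * c.
  by apply: (le_trans UE); rewrite lerD// ?ler_wpM2l// ler_wpM2r.
have : U * expR (- D * l) <= 1 - expR (- D * l) by rewrite /c in Uc; lra.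
rewrite -ler_pdivlMr// mulrBl divff ?gt_eqF// mul1r.
by rewrite mulNr expRN invrK.
Qed.

End renewal.

(** * Generating function of role assignments *)

Section generating_function.
Context {R : realType}.

Lemma sum_exp_coeff_le (x : R) n : 0 <= x ->
  \sum_(i < n) x ^+ i / i`!%:R <= expR x.
Proof.
move=> x0; rewrite expRE /pseries /= -exp_coeffE.
have -> : \sum_(i < n) x ^+ i / i`!%:R = series (exp_coeff x) n.
  by rewrite /series /= big_mkord; apply: eq_bigr => i _; rewrite exp_coeffE mulrC.
apply: (@nondecreasing_cvgn_le _ (series (exp_coeff x))).
  by apply: nondecreasing_series => k _ _; exact: exp_coeff_ge0.
exact: is_cvg_series_exp_coeff.
Qed.

Lemma poisson_generating_le (mu y : R) M : 0 < mu -> 0 <= y ->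
  \sum_(c < M) poisson_pmf mu c * (1 + y) ^+ c <= expR (mu * y).
Proof.
move=> mu0 y0.
have -> : \sum_(c < M) poisson_pmf mu c * (1 + y) ^+ c =
    expR (- mu) * \sum_(c < M) (mu * (1 + y)) ^+ c / c`!%:R.
  rewrite mulr_sumr; apply: eq_bigr => c _; rewrite /poisson_pmf mu0 exprMn.
  ring.
rewrite (_ : mu * y = - mu + mu * (1 + y)); last ring.
rewrite expRD ler_wpM2l ?expR_ge0//; apply: sum_exp_coeff_le.
by rewrite mulr_ge0 ?addr_ge0// ltW.
Qed.

Lemma prod_thinned_le (y : R) m L : 0 <= y ->
  \prod_(j < L) (1 + (if (j < m)%N then y else 0)) <= (1 + y) ^+ m.
Proof.
move=> y0.
have -> : \prod_(j < L) (1 + (if (j < m)%N then y else 0)) = (1 + y) ^+ minn L m.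
  elim: L => [|L IH]; first by rewrite big_ord0 min0n.
  rewrite big_ord_recr /= IH; case: ltnP => Lm.
    by rewrite (minn_idPl Lm) exprSr.
  by rewrite addr0 mulr1 (minn_idPr (leqW Lm)).
by apply: ler_weXn2l; [lra|exact: geq_minr].
Qed.

Context (K L M : nat) (z : R) (b : 'I_K -> 'I_L -> R).

(** An assignment gives each label [s] a value in ['I_K.+1]: [ord0] for no role,
    [lift ord0 k] for the role of the [k]-th member of the family.  Labels that
    carry no particle under the counts [c] must have no role. *)
Definition role_weight (c : {ffun 'I_L -> 'I_M}) (s : 'I_L * 'I_L)
    (o : 'I_K.+1) : R :=
  if unlift ord0 o is Some k
  then (if (s.2 < c s.1)%N then z * b k s.1 else 0) else 1.

(** Roles of different labels are chosen independently, so the sum over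
    assignments is a product over labels; a site with [c] particles contributes
    at most [(1 + y) ^+ c], whose Poisson expectation is [exp (mu y)]. *)
Lemma sum_role_weight_le (mu : R) : 0 < mu -> 0 <= z -> (forall k s, 0 <= b k s) ->
  \sum_(c : {ffun 'I_L -> 'I_M}) \sum_(g : {ffun 'I_L * 'I_L -> 'I_K.+1})
    (\prod_s poisson_pmf mu (c s)) * \prod_a role_weight c a (g a)
  <= expR (mu * (z * \sum_k \sum_s b k s)).
Proof.
move=> mu0 z0 b0.
pose y s := z * \sum_k b k s.
have y0 s : 0 <= y s by rewrite mulr_ge0// sumr_ge0.
have -> : mu * (z * \sum_k \sum_s b k s) = \sum_s mu * y s.
  by rewrite -!mulr_sumr exchange_big.
rewrite expR_sum.
apply: (@le_trans _ _ (\prod_s \sum_(c < M) poisson_pmf mu c * (1 + y s) ^+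
  c)); last first.
  apply: ler_prod => s _; rewrite poisson_generating_le// andbT.
  by apply: sumr_ge0 => c _; rewrite mulr_ge0 ?poisson_pmf_ge0// exprn_ge0// addr_ge0.
rewrite bigA_distr_bigA /=; apply: ler_sum => c _.
rewrite -mulr_sumr big_split /= ler_wpM2l//.
  by apply: prodr_ge0 => s _; exact: poisson_pmf_ge0.
rewrite -bigA_distr_bigA /=.
rewrite -(pair_bigA _ (fun s j => \sum_o role_weight c (s, j) o)) /=.
apply: ler_prod => s _; apply/andP; split.
  apply: prodr_ge0 => j _; apply: sumr_ge0 => o _; rewrite /role_weight.
  by case: unlift => // k; case: ifP => // _; rewrite mulr_ge0.
rewrite (eq_bigr (fun j : 'I_L => 1 + (if (j < c s)%N then y s else 0))).
  exact: prod_thinned_le.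
move=> j _; rewrite big_ord_recl /role_weight unlift_none; congr (_ + _).
under eq_bigr do rewrite liftK.
by case: ifP => _; [rewrite /y mulr_sumr|rewrite big1].
Qed.

End generating_function.

(** * Distinct particles making prescribed jumps *)

Section crossings.
Context {R : realType} {mu D : R} {d} {T : measurableType d}
  {P : probability T R} (S : dla_input mu D P).

Local Notation sigma_of := (joint_sigma (input_sigma S)).

Definition walk_indices (p : particle) : set input_index :=
  [set i | match i with
           | inl (inl _) => False
           | inl (inr (q, _)) => q = p
           | inr (q, _) => q = p
           end].

Lemma jump_chainE w p n : jump_chain S w p n = (p.1.+1)%:Z + displacement S w p n.
Proof. by []. Qed.

Lemma jump_chain_setE p n x :
  [set w | jump_chain S w p n = x] = [set w | displacement S w p n = x - 1 - p.1%:Z].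
Proof. by apply/seteqP; split=> w /=; rewrite jump_chainE; lia. Qed.

(** The number of steps is bounded by [N] to keep all sums finite. *)
Definition hits (N : nat) (p : particle) (x : int) (a l : R) : set T :=
  \big[setU/set0]_(n < N)
    ([set w | a < jump_time S w p n.+1 <= a + l] `&`
     [set w | jump_chain S w p n.+1 = x]).

Lemma hitsE N p x a l : hits N p x a l =
  [set w | exists n, (n < N)%N /\ (a < jump_time S w p n.+1 <= a + l /\
    jump_chain S w p n.+1 = x)].
Proof.
rewrite /hits -(bigcup_mkord N (fun n => [set w | a < jump_time S w p n.+1 <= a + l] `&`
     [set w | jump_chain S w p n.+1 = x])).
by apply/seteqP; split=> w /= [n]; [exists n|case=> ? ?; exists n].
Qed.

Lemma sigma_of_hits N p x a l : sigma_of (walk_indices p) (hits N p x a l).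
Proof.
rewrite /hits; elim/big_ind: _ => //=; first exact: joint_sigma0.
  exact: joint_sigmaU.
move=> n _; apply: joint_sigmaI.
  apply: (@joint_sigma_sub _ _ _ _ (hold_indices p n.+1)).
    by move=> _ [m _ <-].
  exact: (sigma_of_jump_time S p n.+1 (measurable_itv `]a, a + l])).
rewrite jump_chain_setE.
apply: (@joint_sigma_sub _ _ _ _ (coin_indices p n.+1)).
  by move=> _ [m _ <-].
exact: sigma_of_displacement.
Qed.

Lemma measurable_hits N p x a l : measurable (hits N p x a l).
Proof. exact: (joint_sigma_measurable (input_sigma_measurable S)
  (@sigma_of_hits N p x a l)). Qed.

Lemma measurable_jump_chain p n x : measurable [set w | jump_chain S w p n = x].
Proof.
rewrite jump_chain_setE.
exact: (joint_sigma_measurable (input_sigma_measurable S)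
  (sigma_of_displacement S p n _)).
Qed.

(** Written with the jump times of one particular label, so that the starting
    site [i] enters through [walk_law] only. *)
Definition hits_mass (N : nat) (x : int) (a l : R) (i : nat) : R :=
  \sum_(n < N) prob P [set w | a < jump_time S w (0, 0)%N n.+1 <= a + l] *
     walk_law n.+1 (x - 1 - i%:Z).

Lemma hits_mass_ge0 N x a l i : 0 <= hits_mass N x a l i.
Proof.
by apply: sumr_ge0 => n _; rewrite mulr_ge0 ?prob_ge0 ?walk_law_ge0.
Qed.

Lemma prob_hits_le N p x a l : prob P (hits N p x a l) <= hits_mass N x a l p.1.
Proof.
apply: (le_trans (prob_bigsetU _ _ _ _)) => [n|].
  apply: measurableI; first exact: measurable_jump_time_itv.
  exact: measurable_jump_chain.
apply: ler_sum => n _.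
rewrite jump_chain_setE.
have dis : [disjoint hold_indices p n.+1 & coin_indices p n.+1]%classic.
  by apply/disj_set2P; rewrite -subset0 => i [[m _ <-] [m' _]].
rewrite (input_block_indep S dis) ?prob_displacement//.
- rewrite ler_wpM2r ?walk_law_ge0//.
  by rewrite (jump_time_law S p (0, 0)%N n.+1 (measurable_itv `]a, a + l])).
- exact: (sigma_of_jump_time S p n.+1 (measurable_itv `]a, a + l])).
- exact: sigma_of_displacement.
Qed.

Lemma sum_hits_mass_le N x a l L : 0 < D -> 0 <= a -> 0 <= l ->
  \sum_(i < L) hits_mass N x a l i <= expR (D * l) - 1.
Proof.
move=> D_gt0 a0 l0; apply: le_trans (renewal_bound D_gt0 S (0, 0)%N N a0 l0).
rewrite exchange_big /=; apply: ler_sum => n _.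
rewrite -mulr_sumr -[leRHS]mulr1 ler_wpM2l ?prob_ge0//.
exact: (sum_walk_law_le1 n.+1).
Qed.

Lemma prob_count i n : prob P (count S i @^-1` [set n]) = poisson_pmf mu n.
Proof. by rewrite /prob count_law. Qed.

Context (K : nat) (x : 'I_K -> int) (a : 'I_K -> R) (l : R).

(** Truncation of [crossing] below that finitely many assignments of roles
    cover. *)
Definition crossing_upto (L M : nat) : set T :=
  [set w | (exists p : {ffun 'I_K -> nat * nat}, injective p /\
      forall k, [/\ ((p k).1 < L)%N, ((p k).2 < L)%N,
        ((p k).2 < count S (p k).1 w)%N & hits L (p k) (x k) (a k) l w]) /\
    forall i, (i < L)%N -> (count S i w < M)%N].

(** One event for each site and one for each label: together they say that the
    counts are [c] and that every label plays its role in [g]. *)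
Definition assignment_event L M (c : {ffun 'I_L -> 'I_M})
    (g : {ffun 'I_L * 'I_L -> 'I_K.+1}) (b : 'I_L + 'I_L * 'I_L) : set T :=
  match b with
  | inl i => count S i @^-1` [set nat_of_ord (c i)]
  | inr s => if unlift ord0 (g s) is Some k
             then hits L (nat_of_ord s.1, nat_of_ord s.2) (x k) (a k) l
             else setT
  end.

Lemma crossing_upto_sub L M :
  crossing_upto L M `<=`
  \big[setU/set0]_(cg : {ffun 'I_L -> 'I_M} * {ffun 'I_L * 'I_L -> 'I_K.+1} |
      (#|[pred s | cg.2 s != ord0]| == K) &&
      [forall s, (cg.2 s != ord0) ==> (s.2 < cg.1 s.1)%N])
    \big[setI/setT]_(b <- index_enum ('I_L + 'I_L * 'I_L)%type)
      assignment_event cg.1 cg.2 b.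
Proof.
move=> w [[p [pinj pk]] cM].
pose c : {ffun 'I_L -> 'I_M} := [ffun i : 'I_L => Ordinal (cM i (ltn_ord i))].
have pk1 k : ((p k).1 < L)%N by have [] := pk k.
have pk2 k : ((p k).2 < L)%N by have [] := pk k.
pose q k : 'I_L * 'I_L := (Ordinal (pk1 k), Ordinal (pk2 k)).
have qp k : (nat_of_ord (q k).1, nat_of_ord (q k).2) = p k by rewrite /=; case: (p k).
have qinj : injective q.
  by move=> k k' qk; apply: pinj; rewrite -!qp qk.
pose g : {ffun 'I_L * 'I_L ->
  'I_K.+1} := [ffun s : 'I_L * 'I_L =>
    if [pick k | q k == s] is Some k then lift ord0 k else ord0].
have gP s k : unlift ord0 (g s) = Some k -> s = q k.
  rewrite ffunE; case: pickP => [k' /eqP <-|]; last by rewrite unlift_none.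
  by rewrite liftK => -[->].
have gq k : g (q k) = lift ord0 k.
  rewrite ffunE; case: pickP => [k' /eqP /qinj -> //|/(_ k)].
  by rewrite eqxx.
(* Exactly [K] labels have a role, because the family is injective. *)
have gS : [pred s | g s != ord0] =i codom q.
  move=> s; rewrite inE; apply/idP/codomP.
    case: (unliftP ord0 (g s)) => [k gs _|->]; last by rewrite eqxx.
    by exists k; apply: gP; rewrite gs liftK.
  by move=> [k ->]; rewrite gq.
rewrite -bigcup_pred; exists (c, g) => /=.
  apply/andP; split; first by rewrite (eq_card gS) card_codom// card_ord.
  apply/forallP => s; apply/implyP; rewrite -/([pred s | g s != ord0] s).
  move=> gs; have /codomP[k ->] : s \in codom q by rewrite -gS.
  by rewrite ffunE /=; have [] := pk k.
rewrite -bigcap_seq => -[i|s] _ /=; first by rewrite ffunE.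
case gs : (unlift ord0 (g s)) => [k|//].
by rewrite (gP _ _ gs) qp; have [] := pk k.
Qed.


Definition assignment_block L (b : 'I_L + 'I_L * 'I_L) : set input_index :=
  match b with
  | inl i => [set inl (inl (nat_of_ord i))]
  | inr s => walk_indices (nat_of_ord s.1, nat_of_ord s.2)
  end.

Lemma sigma_of_assignment_event L M (c : {ffun 'I_L -> 'I_M}) g b :
  sigma_of (assignment_block b) (assignment_event c g b).
Proof.
case: b => [i|s] /=; first exact: sigma_of_count.
by case: unlift => [k|]; [exact: sigma_of_hits|exact: joint_sigmaT].
Qed.

(** Sites and labels use disjoint blocks of inputs. *)
Lemma prob_assignment_le L M (c : {ffun 'I_L -> 'I_M}) g :
  prob P (\big[setI/setT]_(b <- index_enum ('I_L + 'I_L * 'I_L)%type)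
    assignment_event c g b)
  <= (\prod_i poisson_pmf mu (c i)) *
     \prod_s (if unlift ord0 (g s) is Some k
               then hits_mass L (x k) (a k) l s.1 else 1).
Proof.
have mE b : measurable (assignment_event c g b).
  exact: (joint_sigma_measurable (input_sigma_measurable S)
    (@sigma_of_assignment_event _ _ c g b)).
rewrite [leLHS](_ : _ = \prod_b prob P (assignment_event c g b)); last first.
  apply: EFin_inj; rewrite -probE; last exact: bigsetI_measurable.
  rewrite (joint_sigma_indep_seq (input_mutually_independent S) (input_sigma_algebra S)
    (input_sigma_measurable S) (X := @assignment_block L)).
  - rewrite -prodEFin; apply: eq_bigr => b _; exact: probE.
  - exact: index_enum_uniq.
  - move=> [i|s] [j|t] _ _ st; apply/disj_set2P; rewrite -subset0.
    + move=> e [/= -> []] /val_inj ij.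
      by rewrite ij eqxx in st.
    + by move=> e [/= e1]; rewrite e1.
    + by move=> e [/= + e1]; rewrite e1.
    + move=> e [/= es et]; case/eqP: st; congr inr.
      have : (nat_of_ord s.1, nat_of_ord s.2) = (nat_of_ord t.1, nat_of_ord t.2).
        by move: e es et => [[n|[q n]]|[q n]] //= -> ->.
      by case: s t {es et} => s1 s2 [t1 t2] /= [/val_inj -> /val_inj ->].
  - by move=> b _; exact: sigma_of_assignment_event.
rewrite big_sumType /=; apply: ler_pM.
- by apply: prodr_ge0 => i _; exact: prob_ge0.
- by apply: prodr_ge0 => i _; exact: prob_ge0.
- by apply: ler_prod => i _; rewrite prob_ge0 prob_count lexx.
- apply: ler_prod => s _; rewrite prob_ge0 /=.
  case: unlift => [k|]; last by rewrite /prob probability_setT.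
  exact: prob_hits_le.
Qed.

(** A factor [z] for each of the [K] roles, compensated by [z ^- K], makes it
    possible to drop the constraint on the number of roles.  The choice
    [z = eps^-1] minimises the resulting bound [z ^- K * expR (z * eps * K)]. *)
Lemma prob_crossing_upto_le L M : 0 < mu -> 0 < D -> (forall k, 0 <= a k) -> 0 < l ->
  measurable (crossing_upto L M) ->
  prob P (crossing_upto L M) <= (expR 1 * (mu * (expR (D * l) - 1))) ^+ K.
Proof.
move=> mu0 D0 a0 l0 mC.
set eps := mu * _.
have eps0 : 0 < eps by rewrite mulr_gt0// subr_gt0 -expR0 ltr_expR mulr_gt0.
pose z := eps^-1.
have z0 : 0 < z by rewrite invr_gt0.
have mE c g b : measurable (@assignment_event L M c g b).
  exact: (joint_sigma_measurable (input_sigma_measurable S)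
    (@sigma_of_assignment_event _ _ c g b)).
have mI c g : measurable (\big[setI/setT]_(b <- index_enum ('I_L + 'I_L * 'I_L)%type)
  @assignment_event L M c g b) by exact: bigsetI_measurable.
suff H : prob P (crossing_upto L M) * z ^+ K <= expR 1 ^+ K.
  by rewrite exprMn -ler_pdivrMr ?exprn_gt0// -exprVn.
apply: (@le_trans _ _ (expR (mu * (z * \sum_k \sum_(i < L) hits_mass L (x k) (a
  k) l i)))); last first.
  rewrite -expRM_natl ler_expR mulr1 mulrCA mulrC ler_pdivrMr// mulr_natl.
  rewrite -[X in eps *+ X]card_ord -sumr_const mulr_sumr; apply: ler_sum => k _.
  by rewrite ler_wpM2l ?(ltW mu0)//; apply: sum_hits_mass_le => //; exact: ltW.
have b0 (k : 'I_K) (i : 'I_L) : 0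
  <= hits_mass L (x k) (a k) l i by exact: hits_mass_ge0.
apply: le_trans (sum_role_weight_le M mu0 (ltW z0) b0).
rewrite pair_bigA /= -ler_pdivlMr ?exprn_gt0//.
apply: le_trans.
  apply: (le_prob P mC _ (@crossing_upto_sub L M)).
  by apply: bigsetU_measurable.
apply: le_trans; first exact: prob_bigsetU.
rewrite mulr_suml.
apply: (@le_trans _ _ (\sum_(cg : {ffun 'I_L -> 'I_M} * {ffun 'I_L * 'I_L -> 'I_K.+1} |
      (#|[pred s | cg.2 s != ord0]| == K) &&
      [forall s, (cg.2 s != ord0) ==> (s.2 < cg.1 s.1)%N])
   (\prod_s poisson_pmf mu (cg.1 s)) * (\prod_s
      role_weight z (fun k (i : 'I_L) =>
        hits_mass L (x k) (a k) l i) cg.1 s (cg.2 s)) / z ^+ K)).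
  apply: ler_sum => -[c g] /= /andP[/eqP gK /forallP galive].
  apply: (le_trans (prob_assignment_le c g)).
  rewrite -mulrA ler_wpM2l ?prodr_ge0// => [i _|]; first exact: poisson_pmf_ge0.
  have -> : z ^+ K = \prod_s (if g s != ord0 then z else 1).
    by rewrite -big_mkcond prodr_const; congr (_ ^+ _); exact: (esym gK).
  rewrite ler_pdivlMr; last by apply: prodr_gt0 => s _; case: ifP.
  rewrite -big_split /=.
  apply: ler_prod => s _; apply/andP; split.
    rewrite mulr_ge0//; last by case: ifP => // _; exact: ltW.
    by case: unlift => // k; exact: hits_mass_ge0.
  have := galive s; rewrite /role_weight.
  case: (unliftP ord0 (g s)) => [k ->|->] /=; last by rewrite mulr1.
  by move=> ->; rewrite mulrC.
rewrite big_mkcond /=; apply: ler_sum => cg _; case: ifP => // _.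
rewrite divr_ge0 ?exprn_ge0 ?(ltW z0)// mulr_ge0 ?prodr_ge0// => [i _|s _].
  exact: poisson_pmf_ge0.
rewrite /role_weight; case: unlift => // k; case: ifP => // _.
by rewrite mulr_ge0 ?(ltW z0)// hits_mass_ge0.
Qed.

Lemma measurable_count i (A : set nat) : measurable [set w | A (count S i w)].
Proof. by rewrite -[X in measurable X]setTI; exact: measurable_funP. Qed.

(** Used with the cells of successive advances of the front, with two particles
    in one cell, and with many particles in one cell. *)
Definition crossing : set T :=
  [set w | exists p : {ffun 'I_K -> nat * nat}, injective p /\
    forall k, ((p k).2 < count S (p k).1 w)%N /\
      exists n, a k < jump_time S w (p k) n.+1 <= a k + l /\
        jump_chain S w (p k) n.+1 = x k].

Definition crossing_below (L : nat) : set T :=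
  [set w | exists p : {ffun 'I_K -> nat * nat}, injective p /\
      forall k, [/\ ((p k).1 < L)%N, ((p k).2 < L)%N,
        ((p k).2 < count S (p k).1 w)%N & hits L (p k) (x k) (a k) l w]].

Lemma measurable_crossing : measurable crossing.
Proof.
apply: measurable_exists => p; apply: measurable_and; first exact: measurable_const.
apply: measurable_forall => k; apply: measurable_and.
  exact: (measurable_count _ [set n | ((p k).2 < n)%N]).
apply: measurable_exists => n; apply: measurable_and.
  exact: measurable_jump_time_itv.
exact: measurable_jump_chain.
Qed.

Lemma measurable_crossing_below L : measurable (crossing_below L).
Proof.
apply: measurable_exists => p; apply: measurable_and; first exact: measurable_const.
apply: measurable_forall => k.
have -> : [set w | [/\ ((p k).1 < L)%N, ((p k).2 < L)%N,
    ((p k).2 < count S (p k).1 w)%N & hits L (p k) (x k) (a k) l w]] =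
    [set w | ((p k).1 < L)%N /\ ((p k).2 < L)%N /\
    ((p k).2 < count S (p k).1 w)%N /\ hits L (p k) (x k) (a k) l w].
  by apply/seteqP; split=> w /= => [[]|[? [? []]]].
apply: measurable_and; first exact: measurable_const.
apply: measurable_and; first exact: measurable_const.
apply: measurable_and; last exact: measurable_hits.
exact: (measurable_count _ [set n | ((p k).2 < n)%N]).
Qed.

Lemma measurable_crossing_upto L M : measurable (crossing_upto L M).
Proof.
apply: measurable_and; first exact: measurable_crossing_below.
apply: measurable_forall => i; have [iL|iL] := boolP (i < L)%N.
  rewrite (_ : [set w | _] = [set w | (count S i w < M)%N]).
    exact: (measurable_count _ [set n | (n < M)%N]).
  by apply/seteqP; split=> w /=; [exact|move=> h _].
by rewrite (_ : [set w | _] = setT)//; apply/seteqP; split.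
Qed.

Lemma hits_mono L L' p y b : (L <= L')%N -> hits L p y b l `<=` hits L' p y b l.
Proof.
move=> LL'; rewrite !hitsE => w /= [n [nL nP]]; exists n; split=> //.
exact: leq_trans LL'.
Qed.

Lemma crossing_belowE : crossing = \bigcup_L crossing_below L.
Proof.
apply/seteqP; split=> w.
  move=> [p [pinj pk]].
  have /choice[n nP] : forall k, exists n, a k < jump_time S w (p k) n.+1 <= a k + l /\
        jump_chain S w (p k) n.+1 = x k by move=> k; have [] := pk k.
  pose L := (\max_(k < K) (maxn (p k).1 (maxn (p k).2 (n k)))).+1.
  have kL k : (maxn (p k).1 (maxn (p k).2 (n k)) < L)%N.
    by rewrite ltnS (leq_bigmax k).
  exists L => //; exists p; split=> // k.
  have := kL k; rewrite !gtn_max => /and3P[k1 k2 k3].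
  split=> //; first by have [] := pk k.
  by rewrite hitsE; exists (n k); split.
move=> [L _ [p [pinj pk]]]; exists p; split=> // k; have [_ _ kc] := pk k.
by rewrite hitsE => -[n [_ nP]]; split => //; exists n.
Qed.

Lemma crossing_below_uptoE L : crossing_below L = \bigcup_M crossing_upto L M.
Proof.
apply/seteqP; split=> w; last by move=> [M _ []].
move=> wL; exists (\max_(i < L) count S i w).+1 => //; split=> // i iL.
by rewrite ltnS (leq_bigmax (Ordinal iL)).
Qed.

Lemma prob_crossing_le : 0 < mu -> 0 < D -> (forall k, 0 <= a k) -> 0 < l ->
  prob P crossing <= (expR 1 * (mu * (expR (D * l) - 1))) ^+ K.
Proof.
move=> mu0 D0 a0 l0; rewrite crossing_belowE; apply: prob_bigcup_le.
- exact: measurable_crossing_below.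
- move=> L L' LL'; apply/subsetPset => w [p [pinj pk]]; exists p; split=> // k.
  have [k1 k2 kc kh] := pk k; split=> //; [exact: leq_trans LL'|exact: leq_trans LL'|].
  exact: hits_mono kh.
move=> L; rewrite crossing_below_uptoE; apply: prob_bigcup_le.
- exact: measurable_crossing_upto.
- move=> M M' MM'; apply/subsetPset => w [wL wM]; split=> // i iL.
  exact: leq_trans (wM _ iL) MM'.
by move=> M; apply: prob_crossing_upto_le => //; exact: measurable_crossing_upto.
Qed.

(** On short cells [exp (D l) - 1 <= 2 D l]. *)
Lemma prob_crossing_linear : 0 < mu -> 0 < D -> (forall k, 0 <= a k) -> 0 < l ->
  D * l <= 2^-1 -> prob P crossing <= (2 * expR 1 * mu * D * l) ^+ K.
Proof.
move=> mu0 D0 a0 l0 Dl; apply: (le_trans (prob_crossing_le mu0 D0 a0 l0)).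
have Dl0 : 0 < D * l by exact: mulr_gt0.
have e1 := expR_gt0 (1 : R).
apply: lerXn2r; rewrite ?nnegrE.
- rewrite mulr_ge0 ?(ltW e1)// mulr_ge0 ?(ltW mu0)//.
  by rewrite subr_ge0 -expR0 ler_expR ltW.
- by rewrite mulr_ge0 ?(ltW l0)// mulr_ge0 ?(ltW D0)// mulr_ge0 ?(ltW mu0)//
    mulr_ge0// ltW.
suff H : expR (D * l) - 1 <= 2 * (D * l).
  rewrite (_ : 2 * _ * _ * _ * _ = expR 1 * (mu * (2 * (D * l)))); last ring.
  by rewrite ler_wpM2l ?(ltW e1)// ler_wpM2l// ltW.
have := expR_ge1Dx (- (D * l)); rewrite expRN => h.
have q0 := expR_gt0 (D * l).
have h2 : (1 - D * l) * expR (D * l) <= 1.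
  by rewrite -ler_pdivlMr// div1r.
nra.
Qed.

End crossings.

(** * The front along one path *)

Section front_paths.
Context {R : realType} (J : particle -> nat -> R) (Y : particle -> nat -> int)
  (W0 : set particle).
Context (J0 : forall p, J p 0 = 0) (J_incr : forall p n, J p n < J p n.+1).
Context (Y0 : forall p, 0 < Y p 0)
  (Y_step : forall p n, Y p n.+1 = Y p n + 1 \/ Y p n.+1 = Y p n - 1).
Context (no_simultaneous : forall p q n m, W0 p -> W0 q -> p <> q ->
  J p n.+1 <> J q m.+1).
Context (locally_finite : forall (x : int) (v : R), 0 <= v -> exists e, 0 < e /\
  exists s : seq particle, forall p n, W0 p -> Y p n.+1 = x ->
    v < J p n.+1 < v + e -> p \in s).

Local Notation tau k := (dla_stage J Y W0 k).1.
Local Notation W k := (dla_stage J Y W0 k).2.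

Lemma dla_stageS k : dla_stage J Y W0 k.+1 =
  (ereal_inf [set t%:E | t in
      [set t : R | (tau k < t%:E)%E /\ exists2 p, W k p & jumps_to J Y p k%:Z t]],
   W k `\` [set p | located_before J Y p (k.+1)%:Z (tau k.+1)]).
Proof. by rewrite /=; case: (dla_stage J Y W0 k). Qed.

Lemma tauS k : tau k.+1 = ereal_inf [set t%:E | t in
      [set t : R | (tau k < t%:E)%E /\ exists2 p, W k p & jumps_to J Y p k%:Z t]].
Proof. by rewrite dla_stageS. Qed.

Lemma whiteS k : W k.+1 =
   W k `\` [set p | located_before J Y p (k.+1)%:Z (tau k.+1)].
Proof. by rewrite {1}dla_stageS. Qed.

Lemma tau_leS k : (tau k <= tau k.+1)%E.
Proof.
rewrite tauS; apply: le_ereal_inf_tmp => _ [t [/ltW tk _] <-]; exact: tk.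
Qed.

Lemma tau_le i j : (i <= j)%N -> (tau i <= tau j)%E.
Proof.
move=> /subnK <-; elim: (j - i)%N => // n IH; rewrite addSn.
exact: le_trans IH (tau_leS _).
Qed.

Lemma tau_ge0 k : (0 <= tau k)%E.
Proof. exact: (tau_le (leq0n k)). Qed.

Lemma white_sub i j : (i <= j)%N -> W j `<=` W i.
Proof.
move=> /subnK <-; elim: (j - i)%N => // n IH; rewrite addSn whiteS => p [Wp _].
exact: IH.
Qed.

Lemma jump_time_ltn p m n : (m < n)%N -> J p m < J p n.
Proof.
elim: n => // n IH; rewrite ltnS leq_eqVlt => /predU1P[->//|mn].
exact: lt_trans (IH mn) (J_incr p n).
Qed.

Lemma jump_time_inj p m n : J p m = J p n -> m = n.
Proof.
by move=> e; case: (ltngtP m n) => // /(jump_time_ltn p); rewrite e ltxx.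
Qed.

Lemma jump_time_leq p m n : (m <= n)%N -> J p m <= J p n.
Proof. by rewrite leq_eqVlt => /predU1P[->//|/(jump_time_ltn p)/ltW]. Qed.

(** The jump times of one particle increase, so each particle has an earliest
    jump, and there are finitely many particles. *)
Lemma earliest_jump (Q : particle -> nat -> Prop) (s : seq particle) p0 n0 :
  p0 \in s -> Q p0 n0 -> exists p n, [/\ p \in s, Q p n &
    forall q m, q \in s -> Q q m -> J p n.+1 <= J q m.+1].
Proof.
elim: s p0 n0 => // p s IH p0 n0 p0s Q0.
have one : (exists n, Q p n) -> exists n, Q p n /\ forall m, Q p m ->
  J p n.+1 <= J p m.+1.
  move=> [n Qn]; have exQ : exists n, `[< Q p n >] by exists n; apply/asboolP.
  exists (ex_minn exQ); case: ex_minnP => m /asboolP Qm mmin; split=> // m' Qm'.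
  by apply: jump_time_leq; rewrite ltnS; apply: mmin; apply/asboolP.
have [[q [m [qs Qq]]]|noq] := pselect (exists q m, q \in s /\ Q q m).
  have [q' [m' [q's Qq' q'min]]] := IH _ _ qs Qq.
  have [Qp|noQp] := pselect (exists n, Q p n).
    have [n [Qn nmin]] := one Qp.
    have [le|lt] := leP (J p n.+1) (J q' m'.+1).
      exists p, n; split=> //; first exact: mem_head.
      move=> r k; rewrite inE => /predU1P[->|rs] Qr; first exact: nmin.
      exact: le_trans le (q'min _ _ rs Qr).
    exists q', m'; split=> //; first by rewrite inE q's orbT.
    move=> r k; rewrite inE => /predU1P[->|rs] Qr; last exact: q'min.
    exact: le_trans (ltW lt) (nmin _ Qr).
  exists q', m'; split=> //; first by rewrite inE q's orbT.
  move=> r k; rewrite inE => /predU1P[->|rs] Qr; last exact: q'min.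
  by case: noQp; exists k.
have Qp : exists n, Q p n.
  move: p0s; rewrite inE => /predU1P[pp|p0s]; first by exists n0; rewrite -pp.
  by case: noq; exists p0, n0.
have [n [Qn nmin]] := one Qp.
exists p, n; split=> //; first exact: mem_head.
move=> r k; rewrite inE => /predU1P[->|rs] Qr; first exact: nmin.
by case: noq; exists r, k.
Qed.

(** Just after the infimum only finitely many particles jump to [k], hence the
    infimum is one of their jump times. *)
Lemma tau_attained k : (tau k.+1 < +oo)%E -> exists p n,
  [/\ W k p, Y p n.+1 = k%:Z, tau k.+1 = (J p n.+1)%:E & (tau k < tau k.+1)%E].
Proof.
move=> taufin.
pose Q p n := [/\ W k p, Y p n.+1 = k%:Z & (tau k < (J p n.+1)%:E)%E].
have Qle p n : Q p n -> (tau k.+1 <= (J p n.+1)%:E)%E.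
  move=> [Wp Yp Jp]; rewrite tauS; apply: ereal_inf_lbound.
  by exists (J p n.+1) => //; split=> //; exists p => //; exists n.
have Qlb (y : \bar R) : (forall p n, Q p n -> (y <= (J p n.+1)%:E)%E) ->
  (y <= tau k.+1)%E.
  move=> h; rewrite tauS; apply: le_ereal_inf_tmp => _ [t [tk [p Wp [n [Jt Yn]]]] <-].
  by rewrite -Jt; apply: h; split=> //; rewrite Jt.
have [u uE] : exists u, tau k.+1 = u%:E.
  exists (fine (tau k.+1)); rewrite fineK// ge0_fin_numE//; exact: tau_ge0.
have u0 : 0 <= u by rewrite -lee_fin -uE; exact: tau_ge0.
have [e [e0 [s sP]]] := locally_finite k%:Z u0.
have [att|natt] := pselect (exists p n, Q p n /\ J p n.+1 = u).
  have [p [n [Qpn Jpn]]] := att; exists p, n; case: Qpn => Wp Yp Jp.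
  by split; rewrite ?uE// -?Jpn.
have Qgt p n : Q p n -> u < J p n.+1.
  move=> Qpn; rewrite lt_neqAle; apply/andP; split.
    by apply/eqP => uJ; apply: natt; exists p, n.
  by rewrite -lee_fin -uE; exact: Qle.
have [near|nonear] := pselect (exists p n, Q p n /\ J p n.+1 < u + e).
  have [p0 [n0 Qn0]] := near.
  have Qs p n : Q p n /\ J p n.+1 < u + e -> p \in s.
    move=> [Qpn Jlt]; case: (Qpn) => Wp Yp _; apply: (sP p n) => //.
      exact: (white_sub (leq0n k)).
    by rewrite Jlt (Qgt _ _ Qpn).
  have [p [n [ps [Qpn Jpn] pmin]]] := earliest_jump (Q := fun p n =>
    Q p n /\ J p n.+1 < u + e) (Qs _ _ Qn0) Qn0.
  suff : ((J p n.+1)%:E <= tau k.+1)%E.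
    by rewrite uE lee_fin leNgt (Qgt _ _ Qpn).
  apply: Qlb => q m Qqm; rewrite lee_fin.
  have [Jq|Jq] := ltP (J q m.+1) (u + e); last exact: le_trans (ltW Jpn) Jq.
  by apply: pmin => //; apply: (Qs q m).
suff : ((u + e)%:E <= tau k.+1)%E by rewrite uE lee_fin gerDl leNgt e0.
apply: Qlb => q m Qqm; rewrite lee_fin leNgt; apply/negP => h.
by apply: nonear; exists q, m.
Qed.

(** The position of a white particle at time [tau k], jumps at that time
    included. *)
Definition white_ahead k := forall p n, W k p ->
  ((J p n)%:E <= tau k)%E -> (tau k < (J p n.+1)%:E)%E -> k%:Z < Y p n.

(** A white particle cannot reach [k] before the next advance, since its jump
    there would cause that advance. *)
Lemma white_stays_ahead k p n : white_ahead k -> W k p ->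
  (tau k < (J p n.+1)%:E)%E -> ((J p n)%:E < tau k.+1)%E -> k%:Z < Y p n.
Proof.
move=> Ak Wp; elim: n => [|n IH] tk Jn.
  by apply: Ak => //; rewrite J0; exact: tau_ge0.
have [Jk|Jk] := leP (J p n.+1)%:E (tau k); first exact: Ak.
have kY : k%:Z < Y p n.
  by apply: IH => //; apply: le_lt_trans Jn; rewrite lee_fin; exact: ltW.
have Yk : Y p n.+1 <> k%:Z.
  move=> Yk; move: Jn; rewrite ltNge => /negP; apply; rewrite tauS.
  apply: ereal_inf_lbound; exists (J p n.+1) => //; split=> //.
  by exists p => //; exists n.
by have := Y_step p n; lia.
Qed.

(** A particle at [k.+1] just before the advance turns black, and one at [k.+2]
    can enter [k.+1] at that very moment only together with the particle that
    causes the advance. *)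
Lemma white_aheadP k : white_ahead k.
Proof.
elim: k => [|k IH] p n Wp Jn Jn1.
  case: n Jn Jn1 => [|n] Jn _; first exact: Y0.
  by move: Jn; rewrite lee_fin leNgt -(J0 p) (jump_time_ltn p).
have taufin : (tau k.+1 < +oo)%E by apply: (lt_trans Jn1); rewrite ltry.
have [q [m [Wq Yq tauq tk]]] := tau_attained taufin.
move: Wp; rewrite whiteS => -[Wp nloc].
have {}nloc i : ((J p i)%:E < tau k.+1)%E -> (tau k.+1 <= (J p i.+1)%:E)%E ->
  Y p i <> k.+1%:Z.
  by move=> h1 h2 Yi; apply: nloc; exists i; rewrite h1 h2.
move: Jn; rewrite le_eqVlt => /predU1P[Jn|Jn]; last first.
  have := nloc n Jn (ltW Jn1).
  have := white_stays_ahead IH Wp (lt_trans tk Jn1) Jn.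
  lia.
case: n Jn Jn1 => [|n] Jn _.
  by move: tk; rewrite -Jn J0 ltNge tau_ge0.
have Jlt : ((J p n)%:E < tau k.+1)%E by rewrite -Jn lte_fin.
have Yn : k%:Z < Y p n by apply: (white_stays_ahead IH) => //; rewrite Jn.
have Yn1 := nloc n Jlt; rewrite Jn lexx in Yn1.
have Ynk : Y p n.+1 <> k.+1%:Z.
  move=> YS; have Jpq : J p n.+1 = J q m.+1 by apply: EFin_inj; rewrite Jn.
  have [pq|pq] := pselect (p = q); last first.
    by apply: no_simultaneous Jpq => //; exact: (white_sub (leq0n k)).
  by move: Jpq Yq YS; rewrite pq => /(@jump_time_inj q) -> ->; lia.
have := Y_step p n; have := Yn1 isT; lia.
Qed.

(** The particle that causes an advance came from [k.+1], by
    [white_stays_ahead], so it turns black and never causes another one: the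
    particles are distinct. *)
Lemma front_advance_jumps K t : (tau K <= t%:E)%E ->
  exists (p : 'I_K -> particle) (n : 'I_K -> nat),
  [/\ injective p,
     forall k, [/\ W0 (p k), Y (p k) (n k).+1 = k%:Z & 0 < J (p k) (n k).+1 <= t]
   & forall i j : 'I_K, (i <= j)%N -> J (p i) (n i).+1 <= J (p j) (n j).+1].
Proof.
move=> tK.
have fin k : (k < K)%N -> (tau k.+1 < +oo)%E.
  by move=> kK; apply: le_lt_trans (ltry t); exact: le_trans (tau_le kK) tK.
have /choice[pn pnP] : forall k : 'I_K, exists pn : particle * nat,
    [/\ W k pn.1, Y pn.1 pn.2.+1 = k%:Z, tau k.+1 = (J pn.1 pn.2.+1)%:E
      & (tau k < tau k.+1)%E].
  by move=> k; have [p [n h]] := tau_attained (fin _ (ltn_ord k)); exists (p, n).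
exists (fun k => (pn k).1), (fun k => (pn k).2).
have black (k : 'I_K) : ~ W k.+1 (pn k).1.
  have [Wk Yk tk tlt] := pnP k.
  rewrite whiteS => -[_]; apply; exists (pn k).2.
  have Jlt : ((J (pn k).1 (pn k).2)%:E < tau k.+1)%E by rewrite tk lte_fin.
  split; first by rewrite Jlt tk lexx.
  have := @white_stays_ahead k _ (pn k).2 (@white_aheadP k) Wk.
  rewrite -tk => /(_ tlt Jlt).
  have := Y_step (pn k).1 (pn k).2; rewrite Yk; lia.
have neq (i j : 'I_K) : (i < j)%N -> (pn i).1 <> (pn j).1.
  move=> ij e; apply: (black i); rewrite e.
  by apply: (white_sub ij); have [] := pnP j.
split.
- move=> i j e; apply: val_inj => /=; case: (ltngtP i j) => // ij.
    by case: (neq _ _ ij).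
  by case: (neq _ _ ij).
- move=> k; have [Wk Yk tk tlt] := pnP k; split => //.
    exact: (white_sub (leq0n k)).
  apply/andP; split; rewrite -?lte_fin -?lee_fin -tk.
    exact: le_lt_trans (tau_ge0 k) tlt.
  exact: le_trans (tau_le (ltn_ord k)) tK.
- move=> i j ij; have [_ _ ti _] := pnP i; have [_ _ tj _] := pnP j.
  by rewrite -lee_fin -ti -tj; apply: tau_le; rewrite ltnS.
Qed.

End front_paths.

(** * Almost sure properties of the paths *)

Section negligible_facts.
Context {d} {T : measurableType d} {R : realType} (P : probability T R).

Lemma negligible_exists (I : countType) (Q : I -> T -> Prop) :
  (forall i, P.-negligible [set w | Q i w]) ->
  P.-negligible [set w | exists i, Q i w].
Proof.
move=> nQ; pose F n := if choice.unpickle n is Some i then [set w | Q i w] else set0.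
apply: (@negligibleS _ _ _ _ (\bigcup_n F n)).
  by move=> w [i Qi]; exists (choice.pickle i) => //; rewrite /F choice.pickleK.
apply: negligible_bigcup => n; rewrite /F; case: choice.unpickle => // ;
  exact: negligible_set0.
Qed.

Lemma negligible_small (A : set T) :
  (forall e, 0 < e -> exists B, [/\ measurable B, A `<=` B & prob P B <= e]) ->
  P.-negligible A.
Proof.
move=> h; have /choice[B BP] : forall n : nat, exists B, [/\ measurable B,
  A `<=` B & prob P B <= n.+1%:R^-1].
  by move=> n; apply: h; rewrite invr_gt0 ltr0n.
have mB : measurable (\bigcap_n B n) by apply: bigcapT_measurable => n; have [] := BP n.
apply: (@negligibleS _ _ _ _ (\bigcap_n B n)).
  by move=> w Aw n _; have [_ + _] := BP n; apply.
apply: negligible_prob => //.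
rewrite leNgt; apply/negP => p0.
have := truncnS_gt (prob P (\bigcap_n B n))^-1.
set n := Num.trunc _; rewrite -invf_plt ?posrE ?ltr0n// => pn.
have [mBn _ Bn] := BP n.
have : prob P (\bigcap_n B n) <= prob P (B n) by apply: le_prob => //;
  exact: bigcap_inf.
by move=> /le_trans /(_ Bn); rewrite leNgt pn.
Qed.

End negligible_facts.

Lemma exists_cell {R : realType} (u l : R) : 0 < u -> 0 < l ->
  exists c : nat, c%:R * l < u <= c%:R * l + l.
Proof.
move=> u0 l0.
have ex : exists n : nat, u <= n%:R * l.
  exists (Num.trunc (u / l)).+1; rewrite -ler_pdivrMr//.
  by apply: ltW; exact: truncnS_gt.
case: (ex_minnP ex) => -[|c] uc cmin; first by move: uc; rewrite mul0r leNgt u0.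
exists c; apply/andP; split; last by rewrite -natr1 mulrDl mul1r in uc.
by rewrite ltNge; apply/negP => /cmin; rewrite ltnn.
Qed.

(** If every finite set misses some element, elements can be chosen one after
    another to form a family of any size. *)
Lemma finite_of_no_family (Q : particle -> Prop) K :
  ~ (exists p : {ffun 'I_K -> nat * nat}, injective p /\ forall k, Q (p k)) ->
  exists s : seq particle, forall p, Q p -> p \in s.
Proof.
move=> noK; apply: contrapT => nos.
have : forall s : seq particle, exists p, Q p /\ p \notin s.
  move=> s; apply: contrapT => h; apply: nos; exists s => p Qp.
  by apply: contrapT => /negP ps; apply: h; exists p.
move=> /choice[f fP].
pose t n := iter n (fun s => f s :: s) [::].
have t_size n : size (t n) = n by elim: n => //= n ->.
have t_uniq n : uniq (t n) by elim: n => //= n ->; have [_ ->] := fP (t n).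
have tQ n p : p \in t n -> Q p.
  elim: n => // n IH; rewrite /= inE => /predU1P[->|]; last exact: IH.
  by have [] := fP (t n).
apply: noK; exists [ffun k : 'I_K => nth (0, 0)%N (t K) k]; split.
  move=> i j; rewrite !ffunE => /eqP; rewrite nth_uniq ?t_size// => /eqP.
  exact: val_inj.
by move=> k; rewrite ffunE; apply: (tQ K); rewrite mem_nth// t_size.
Qed.

Section almost_sure.
Context {R : realType} {mu D : R} {d} {T : measurableType d}
  {P : probability T R} (mu_gt0 : 0 < mu) (D_gt0 : 0 < D) (S : dla_input mu D P).

Local Notation kappa := (2 * expR 1 * mu * D).

Definition alive w (p : particle) : Prop := (p.2 < count S p.1 w)%N.

Lemma negligible_hold_le0 :
  P.-negligible [set w | exists pn : particle * nat, hold S pn.1 pn.2 w <= 0].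
Proof.
apply: negligible_exists => -[p n]; apply: negligible_prob.
  exact: measurable_hold_le.
by rewrite prob_hold_le0.
Qed.

Lemma fine_mesh (b : R) : 0 < b -> exists m : nat, (0 < m)%N /\
  forall M, (m <= M)%N -> D * M%:R^-1 <= 2^-1 /\ kappa * M%:R^-1 <= b.
Proof.
move=> b0; pose m := (Num.trunc (2 * D + kappa / b)).+1.
exists m; split => // M mM.
have k0 : 0 < kappa by rewrite !mulr_gt0// expR_gt0.
have kb0 : 0 < kappa / b by rewrite divr_gt0.
have M0 : 0 < M%:R :> R by rewrite ltr0n (leq_trans _ mM).
have h : 2 * D + kappa / b <= M%:R.
  apply: le_trans (ltW (truncnS_gt _)) _; by rewrite ler_nat.
have D2 : 0 < 2 * D by exact: mulr_gt0.
have h2 : 2 * D <= M%:R by apply: (le_trans _ h); rewrite lerDl; exact: ltW.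
split; rewrite ler_pdivrMr//; first by lra.
by rewrite [leRHS]mulrC -ler_pdivrMr//; apply: (le_trans _ h); rewrite lerDr;
  exact: ltW.
Qed.

(** Two simultaneous jumps fall in the same cell of every mesh.  Up to time [t]
    there are [t m] cells of length [m^-1], and each has probability of order
    [m ^- 2]. *)
Lemma negligible_simultaneous :
  P.-negligible [set w | exists i : int * int * nat,
  exists p q n m, [/\ alive w p, alive w q, p <> q &
   [/\ 0 < jump_time S w p n.+1 <= i.2%:R, jump_time S w p n.+1 = jump_time S w q m.+1,
      jump_chain S w p n.+1 = i.1.1 & jump_chain S w q m.+1 = i.1.2]]].
Proof.
apply: negligible_exists => -[[x y] t]; apply: negligible_small => e e0 /=.
(* The union bound gives [kappa ^+ 2 * t / m], which this mesh makes small. *)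
have e1 : 0 < e / (kappa * t.+1%:R).
  by rewrite divr_gt0// !mulr_gt0// ?expR_gt0// ltr0n.
have [m [m0 mP]] := fine_mesh e1.
have [mD mk] := mP m (leqnn m).
pose l : R := m%:R^-1.
have l0 : 0 < l by rewrite invr_gt0 ltr0n.
pose xy (k : 'I_2) : int := if k == 0 :> nat then x else y.
pose B := \big[setU/set0]_(c < t * m) crossing S xy (fun=> c%:R * l) l.
have mB c : measurable (crossing S xy (fun=> c%:R * l) l) by exact: measurable_crossing.
exists B; split.
- by apply: bigsetU_measurable.
- move=> w [p [q [n [n' [wp wq pq [/andP[J0 Jt] Jpq Yp Yq]]]]]].
  have [c /andP[c1 c2]] := exists_cell J0 l0.
  have ct : (c < t * m)%N.
    rewrite -(ltr_nat R) natrM -ltr_pdivrMr ?ltr0n//.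
    exact: lt_le_trans c1 Jt.
  rewrite /B -(bigcup_mkord (t * m) (fun c => crossing S xy (fun=> c%:R * l) l)).
  exists c => //; exists [ffun k : 'I_2 => if k == 0 :> nat then p else q]; split.
    move=> [[|[|//]] ki] [[|[|//]] kj]; rewrite !ffunE /= => E; apply: val_inj => //=.
    by case: pq.
  move=> [[|[|//]] ki]; rewrite !ffunE /xy /=; split => //.
    by exists n; rewrite c1 c2.
  by exists n'; rewrite -Jpq c1 c2.
- apply: (le_trans (prob_bigsetU _ _ _ _)) => //.
  apply: (@le_trans _ _ (\sum_(c < t * m) (kappa * l) ^+ 2)).
    apply: ler_sum => c _; apply: prob_crossing_linear => // _.
    by rewrite mulr_ge0// ltW.
  rewrite sumr_const card_ord -[leLHS]mulr_natl natrM.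
  rewrite (_ : t%:R * m%:R * _ = (kappa * t%:R) * (kappa * l)); last first.
    rewrite /l; field; by rewrite pnatr_eq0 -lt0n.
  apply: (@le_trans _ _ ((kappa * t.+1%:R) * (kappa * l))).
    rewrite ler_wpM2r//; first by rewrite !mulr_ge0 ?expR_ge0 ?ltW.
    rewrite ler_wpM2l ?ler_nat//.
    by rewrite !mulr_ge0 ?expR_ge0 ?ltW.
  rewrite -ler_pdivlMl; last by rewrite !mulr_gt0 ?expR_gt0// ltr0n.
  by rewrite [leRHS]mulrC.
Qed.

(** On a mesh with [kappa / m <= 2^-1], at least [K] particles jump to a given
    site in a given cell with probability at most [2 ^- K]. *)
Lemma negligible_crowded : exists m : nat, (0 < m)%N /\
  P.-negligible [set w | exists i : int * nat,
    forall K,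
      crossing S (fun _ : 'I_K => i.1) (fun=> i.2%:R * m%:R^-1) m%:R^-1 w].
Proof.
have h0 : (0 : R) < 2^-1 by rewrite invr_gt0.
have [m [m0 mP]] := fine_mesh h0.
exists m; split => //; apply: negligible_exists => -[x c] /=.
have [mD mk] := mP m (leqnn m).
have l0 : 0 < m%:R^-1 :> R by rewrite invr_gt0 ltr0n.
apply: negligible_small => e e0.
have [n ne] : exists n, (2^-1 : R) ^+ n <= e.
  exists (Num.trunc e^-1).+1;
    rewrite exprVn -[leRHS]invrK lef_pV2 ?posrE ?invr_gt0 ?exprn_gt0//.
  apply: (le_trans (ltW (truncnS_gt _))); rewrite -natrX ler_nat ltnW//.
  exact: ltn_expl.
exists (crossing S (fun _ : 'I_n => x) (fun=> c%:R * m%:R^-1) m%:R^-1); split.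
- exact: measurable_crossing.
- by move=> w; apply.
- apply: le_trans ne; apply: le_trans.
    by apply: prob_crossing_linear => // _; rewrite mulr_ge0// ltW.
  by apply: lerXn2r; rewrite ?nnegrE// !mulr_ge0 ?expR_ge0 ?ltW.
Qed.

Definition good_path w : Prop :=
  [/\ forall p n, 0 < hold S p n w,
    forall p q n m, alive w p -> alive w q -> p <> q ->
      jump_time S w p n.+1 <> jump_time S w q m.+1
  & forall (x : int) (v : R), 0 <= v -> exists e, 0 < e /\
      exists s : seq particle, forall p n, alive w p ->
        jump_chain S w p n.+1 = x -> v < jump_time S w p n.+1 < v + e -> p \in s].

Lemma jump_time_gt0 w p n : (forall n, 0 < hold S p n w) -> 0 < jump_time S w p n.+1.
Proof.
move=> h; elim: n => [|n IH]; rewrite jump_timeS; first by rewrite jump_time0 add0r.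
exact: addr_gt0.
Qed.

(** The last property of [good_path] at time [v] concerns the cell that contains
    [v]: outside [negligible_crowded], boundedly many particles jump to [x] in
    this cell. *)
Lemma negligible_bad_path : P.-negligible [set w | ~ good_path w].
Proof.
have [m [m0 crowded]] := negligible_crowded.
apply: negligibleS (negligibleU negligible_hold_le0 (negligibleU
  negligible_simultaneous crowded)).
move=> w bad; apply: contrapT => /not_orP[nhold /not_orP[nsim ncrowd]]; apply: bad.
have hold0 p n : 0 < hold S p n w.
  by rewrite ltNge; apply/negP => h; apply: nhold; exists (p, n).
split => //.
- move=> p q n n' wp wq pq Jpq; apply: nsim.
  exists (jump_chain S w p n.+1, jump_chain S w q n'.+1,
    (Num.trunc (jump_time S w p n.+1)).+1).
  exists p, q, n, n'; split => //; split => //.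
  by rewrite (jump_time_gt0 _ (hold0 p)) ltW// truncnS_gt.
- move=> x v v0; have m1 : 0 < m%:R :> R by rewrite ltr0n.
  have := truncn_itv (mulr_ge0 v0 (ltW m1)); set c := Num.trunc _ => /andP[c1 c2].
  have c3 : v < c%:R / m%:R + m%:R^-1.
    by rewrite -[X in _ + X]mul1r -mulrDl natr1 ltr_pdivlMr.
  exists (c%:R / m%:R + m%:R^-1 - v); split; first by rewrite subr_gt0.
  have [K nK] : exists K, ~ crossing S (fun _ : 'I_K =>
    x) (fun=> c%:R / m%:R) m%:R^-1 w.
    apply: contrapT => h; apply: ncrowd; exists (x, c) => K.
    by apply: contrapT => h'; apply: h; exists K.
  have [s sP] := finite_of_no_family (Q := fun p => alive w p /\
    exists n, c%:R / m%:R < jump_time S w p n.+1 <= c%:R / m%:R + m%:R^-1 /\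
      jump_chain S w p n.+1 = x) nK.
  exists s => p n wp px /andP[vJ Jv]; apply: sP; split => //.
  exists n; split => //; rewrite (le_lt_trans _ vJ) /=; last by rewrite ler_pdivrMr.
  by rewrite (le_trans (ltW Jv))// addrC subrK.
Qed.

End almost_sure.

(** * Measurability of the front *)

Section front_measurable.
Context {R : realType} {mu D : R} {d} {T : measurableType d}
  {P : probability T R} (S : dla_input mu D P).

Definition tau (w : T) (k : nat) : \bar R :=
  (dla_stage (jump_time S w) (jump_chain S w) (initial_particles S w) k).1.

Definition white (w : T) (k : nat) : set particle :=
  (dla_stage (jump_time S w) (jump_chain S w) (initial_particles S w) k).2.

Lemma tau0 w : tau w 0 = 0%E. Proof. by []. Qed.

(** A strict upper bound passes through the infimum without any attainment. *)
Lemma tau_lt w k (y : R) : (tau w k.+1 < y%:E)%E <->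
  exists p n, [/\ white w k p, jump_chain S w p n.+1 = k%:Z,
    (tau w k < (jump_time S w p n.+1)%:E)%E & jump_time S w p n.+1 < y].
Proof.
rewrite {1}/tau tauS; split.
  move=> /ereal_inf_lt[_ [t [tk [p Wp [n [Jt Yn]]]] <-]].
  by rewrite lte_fin => ty; exists p, n; split => //; rewrite Jt.
move=> [p [n [Wp Yp tk Jy]]]; apply: (@le_lt_trans _ _ (jump_time S w p n.+1)%:E).
  apply: ereal_inf_lbound; exists (jump_time S w p n.+1) => //; split=> //.
  by exists p => //; exists n.
by rewrite lte_fin.
Qed.

Lemma measurable_set_lt (f g : T -> R) : measurable_fun setT f ->
  measurable_fun setT g ->
  measurable [set w | f w < g w].
Proof.
move=> mf mg; have := measurable_funB mg mf measurableT (measurable_itv `]0, +oo[).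
rewrite setTI; congr measurable.
by apply/seteqP; split=> w /=; rewrite in_itv/= andbT subr_gt0.
Qed.

Lemma le_tau_eps w k (y : R) : (tau w k <= y%:E)%E <->
  forall n : nat, (tau w k < (y + n.+1%:R^-1)%:E)%E.
Proof.
split=> [h n|h].
  by apply: (le_lt_trans h); rewrite lte_fin ltrDl invr_gt0 ltr0n.
apply/lee_addgt0Pr => e e0; apply: (le_trans (ltW (h (Num.trunc e^-1)))).
rewrite -EFinD lee_fin lerD2l -[leRHS]invrK lef_pV2 ?posrE ?invr_gt0 ?ltr0n//.
exact: ltW (truncnS_gt _).
Qed.

(** Comparison with random times [f] is what the induction needs, as [tau] is
    compared with jump times.  Weak inequalities come from strict ones by
    [le_tau_eps]. *)
Lemma measurable_stage k :
  (forall p, measurable [set w | white w k p]) /\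
  (forall f : T -> R, measurable_fun setT f ->
     measurable [set w | (tau w k < (f w)%:E)%E]).
Proof.
elim: k => [|k [mW mtau]].
  split=> [p|f mf]; first exact: (measurable_count S p.1 [set n | (p.2 < n)%N]).
  rewrite (_ : [set w | _] = [set w | cst 0 w < f w]).
    exact: measurable_set_lt.
  by apply/seteqP; split=> w /=; rewrite tau0 lte_fin.
have mtauS (f : T -> R) : measurable_fun setT f ->
    measurable [set w | (tau w k.+1 < (f w)%:E)%E].
  move=> mf; rewrite (_ : [set w | _] = [set w | exists p n, white w k p /\
    jump_chain S w p n.+1 = k%:Z /\ (tau w k < (jump_time S w p n.+1)%:E)%E /\
    jump_time S w p n.+1 < f w]); last first.
    apply/seteqP; split=> w /=.
      by move=> /tau_lt[p [n [? ? ? ?]]]; exists p, n.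
    by move=> [p [n [? [? [? ?]]]]]; apply/tau_lt; exists p, n.
  apply: measurable_exists => p; apply: measurable_exists => n.
  apply: measurable_and => //; apply: measurable_and;
    first exact: measurable_jump_chain.
  apply: measurable_and; first by apply: mtau; exact: measurable_jump_time.
  by apply: measurable_set_lt => //; exact: measurable_jump_time.
split=> // p.
have mle n : measurable [set w | (tau w k.+1 <= (jump_time S w p n)%:E)%E].
  rewrite (_ : [set w | _] = [set w | forall i : nat,
     (tau w k.+1 < (jump_time S w p n + i.+1%:R^-1)%:E)%E]); last first.
    by apply/seteqP; split=> w /= /le_tau_eps.
  apply: measurable_forall => i; apply: mtauS; apply: measurable_funD => //.
  exact: measurable_jump_time.
rewrite (_ : [set w | _] = [set w | white w k p] `\` [set w | exists n,
   ~ (tau w k.+1 <= (jump_time S w p n)%:E)%E /\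
   (tau w k.+1 <= (jump_time S w p n.+1)%:E)%E /\ jump_chain S w p n = k.+1%:Z]).
  apply: measurableD => //; apply: measurable_exists => n; apply: measurable_and.
    exact: (measurableC (mle n)).
  by apply: measurable_and => //; exact: measurable_jump_chain.
apply/seteqP; split=> w; rewrite /white /= -/(dla_stage _ _ _ k.+1) whiteS.
  move=> [Wp nloc]; split => // -[n [h1 [h2 h3]]]; apply: nloc; exists n.
  by split => //; rewrite ltNge; apply/andP; split => //; apply/negP.
move=> [Wp nloc]; split => // -[n [/andP[h1 h2] h3]]; apply: nloc; exists n.
by split => //; apply/negP; rewrite -ltNge.
Qed.

Lemma measurable_tau_le k (t : R) : measurable [set w | (tau w k <= t%:E)%E].
Proof.
rewrite (_ : [set w | _] =
  [set w | forall i : nat, (tau w k < (t + i.+1%:R^-1)%:E)%E]); last first.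
  by apply/seteqP; split=> w /= /le_tau_eps.
by apply: measurable_forall => i; apply: (measurable_stage k).2.
Qed.

Lemma DLA_gt w (t y : R) : (y%:E < DLA S w t)%E <->
  exists k : nat, y < k%:R /\ (tau w k <= t%:E)%E.
Proof.
split.
  by move=> /ereal_sup_gt[_ [k tk <-]]; rewrite lte_fin => yk; exists k.
move=> [k [yk tk]]; apply: (@lt_le_trans _ _ k%:R%:E); first by rewrite lte_fin.
by apply: ereal_sup_ubound; exists k.
Qed.

Lemma measurable_DLA_gt (t y : R) : measurable [set w | (y%:E < DLA S w t)%E].
Proof.
rewrite (_ : [set w | _] =
  [set w | exists k : nat, y < k%:R /\ (tau w k <= t%:E)%E]); last first.
  by apply/seteqP; split=> w /= /DLA_gt.
apply: measurable_exists => k; apply: measurable_and; first exact: measurable_const.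
exact: measurable_tau_le.
Qed.

Lemma DLA_mono w (t t' : R) : t <= t' -> (DLA S w t <= DLA S w t')%E.
Proof.
move=> tt'; apply: ub_ereal_sup => _ [k tk <-]; apply: ereal_sup_ubound.
by exists k => //; apply: (le_trans tk); rewrite lee_fin.
Qed.

End front_measurable.

(** * The speed of the front *)

Lemma bin_le_expn n m : ('C(n, m) <= 2 ^ n)%N.
Proof.
elim: n m => [|n IH] [|m] //; first by rewrite bin0 expn_gt0.
by rewrite binS expnS mul2n -addnn leq_add.
Qed.

Lemma le_prob_negligible d (T : measurableType d) (R : realType) (P : probability T R)
    (A B N : set T) : measurable A -> measurable B -> P.-negligible N ->
  A `<=` B `|` N -> prob P A <= prob P B.
Proof.
move=> mA mB [N' [mN' N'0 NN']] AB.
apply: (@le_trans _ _ (prob P (B `|` N'))).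
  apply: le_prob => //; first exact: measurableU.
  by move=> w /AB[]; [left|right; exact: NN'].
apply: (le_trans (probU _ _ _)) => //.
by rewrite /prob [P N']N'0 addr0.
Qed.

(** With [K > speed * t] the first summand makes [8 e mu D t / K] at most
    [exp (-1)]; the second one makes the cells short enough for
    [prob_crossing_linear]. *)
Definition speed {R : realType} (mu D : R) : R :=
  4 * expR 1 * (2 * expR 1 * mu * D) + 2 * D.

Section front_bound.
Context {R : realType} {mu D : R} {d} {T : measurableType d}
  {P : probability T R} (mu_gt0 : 0 < mu) (D_gt0 : 0 < D) (S : dla_input mu D P).

Local Notation kappa := (2 * expR 1 * mu * D).

(** The [k]-th advance takes place in cell number [tnth c k], for the mesh of
    [K.+1] cells between times [0] and [t]. *)
Definition time_cells K (t : R) (c : K.+1.-tuple 'I_K.+1) : set T :=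
  crossing S (fun k : 'I_K.+1 => k%:Z)
    (fun k => (tnth c k)%:R * (t / K.+1%:R)) (t / K.+1%:R).

Lemma fast_front_sub K t : 0 < t ->
  [set w | (tau S w K.+1 <= t%:E)%E] `&` [set w | good_path S w] `<=`
  \big[setU/set0]_(c : K.+1.-tuple 'I_K.+1 | sorted leq (map val c)) time_cells t c.
Proof.
move=> t0 w [/= tk [hold0 nosim locfin]].
have Jincr p n : jump_time S w p n < jump_time S w p n.+1.
  by rewrite jump_timeS ltrDl.
have Y0 p : 0 < jump_chain S w p 0.
  by rewrite /jump_chain big_ord0 addr0.
have Ystep p n : jump_chain S w p n.+1 = jump_chain S w p n + 1 \/
    jump_chain S w p n.+1 = jump_chain S w p n - 1.
  by rewrite /jump_chain big_ord_recr /=; case: (coin S p n w); [left|right];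
    rewrite addrA.
have [p [n [pinj pn mono]]] :=
  front_advance_jumps (jump_time0 S w) Jincr Y0 Ystep nosim locfin tk.
pose l := t / K.+1%:R.
have l0 : 0 < l by rewrite divr_gt0// ltr0n.
pose u k := jump_time S w (p k) (n k).+1.
have u0 k : 0 < u k by have [_ _ /andP[]] := pn k.
have /choice[c cP] := fun k => exists_cell (u0 k) l0.
have cK k : (c k < K.+1)%N.
  have /andP[c1 _] := cP k; have [_ _ /andP[_ ut]] := pn k.
  rewrite -(ltr_nat R) -(ltr_pM2r l0) (lt_le_trans c1)//.
  by rewrite /l mulrC divfK// pnatr_eq0.
have cmono (i j : 'I_K.+1) : (i <= j)%N -> (c i <= c j)%N.
  move=> ij; have /andP[c1 _] := cP i; have /andP[_ c2] := cP j.
  rewrite -ltnS -(ltr_nat R) -(ltr_pM2r l0) (lt_le_trans c1)//.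
  rewrite (le_trans (mono _ _ ij))// -natr1 mulrDl mul1r; exact: c2.
pose ct := [tuple Ordinal (cK k) | k < K.+1].
rewrite -bigcup_pred; exists ct => /=.
  rewrite ?inE; apply/(sortedP 0%N) => i; rewrite size_map size_tuple => iK.
  have iK' := ltnW iK.
  rewrite (nth_map ord0) ?size_tuple// (nth_map ord0) ?size_tuple//.
  rewrite (nth_mktuple _ _ (Ordinal iK')) (nth_mktuple _ _ (Ordinal iK)) /=.
  exact: cmono.
exists [ffun k => p k]; split; first by move=> i j; rewrite !ffunE; exact: pinj.
move=> k; rewrite ffunE tnth_mktuple /=; have [Wp Yp _] := pn k; split => //.
by exists (n k); split => //; exact: cP.
Qed.

(** There are ['C(2 K + 1, K + 1) <= 4 ^ (K + 1)] nondecreasing sequences of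
    cells. *)
Lemma prob_fast_front_le K t : 0 < t -> D * (t / K.+1%:R) <= 2^-1 ->
  prob P [set w | (tau S w K.+1 <= t%:E)%E]
  <= (4 * kappa * (t / K.+1%:R)) ^+ K.+1.
Proof.
move=> t0 Dl; have l0 : 0 < t / K.+1%:R by rewrite divr_gt0// ltr0n.
have mc c : measurable (@time_cells K t c) by exact: measurable_crossing.
apply: (@le_trans _ _ (prob P (\big[setU/set0]_(c :
  K.+1.-tuple 'I_K.+1 | sorted leq (map val c)) time_cells t c))).
  apply: (le_prob_negligible _ _ (negligible_bad_path mu_gt0 D_gt0 S)).
  - exact: measurable_tau_le.
  - exact: bigsetU_measurable.
  - move=> w tk; have [gw|] := pselect (good_path S w); last by right.
    by left; apply: fast_front_sub.
apply: le_trans; first exact: prob_bigsetU.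
apply: (@le_trans _ _ (\sum_(c :
  K.+1.-tuple 'I_K.+1 | sorted leq (map val c)) (kappa * (t / K.+1%:R)) ^+ K.+1)).
  apply: ler_sum => c _; apply: prob_crossing_linear => // k.
  by rewrite mulr_ge0// ltW.
rewrite sumr_const -[leLHS]mulr_natl.
rewrite -[X in _ <= X ^+ _]mulrA [leRHS]exprMn ler_wpM2r//.
  by rewrite exprn_ge0// !mulr_ge0 ?expR_ge0 ?ltW.
rewrite -natrX ler_nat -cardsE card_sorted_tuples.
apply: (leq_trans (bin_le_expn _ _)).
by rewrite (_ : 4 = 2 ^ 2)%N// -expnM leq_exp2l//; lia.
Qed.


Lemma speed_gt0 : 0 < speed mu D.
Proof. by rewrite addr_gt0// !mulr_gt0 ?expR_gt0. Qed.

Lemma prob_DLA_le t : 0 < t ->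
  prob P [set w | ((speed mu D * t)%:E < DLA S w t)%E] <= expR (- (speed mu D * t)).
Proof.
move=> t0; have s0 := speed_gt0.
have st0 : 0 < speed mu D * t by exact: mulr_gt0.
pose K := Num.trunc (speed mu D * t).
have sK : speed mu D * t < K.+1%:R by exact: truncnS_gt.
have tK : t / K.+1%:R <= (speed mu D)^-1.
  rewrite ler_pdivrMr ?ltr0n// -ler_pdivrMl ?invr_gt0// invrK; exact: ltW.
have l0 : 0 <= t / K.+1%:R by rewrite divr_ge0// ltW.
have k0 : 0 < kappa by rewrite !mulr_gt0// expR_gt0.
have e0 := expR_gt0 (1 : R).
have Dl : D * (t / K.+1%:R) <= 2^-1.
  apply: (@le_trans _ _ (D * (speed mu D)^-1)); first by rewrite ler_wpM2l// ltW.
  rewrite ler_pdivrMr// /speed.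
  have : 0 <= 4 * expR 1 * kappa by rewrite !mulr_ge0 ?expR_ge0 ?ltW.
  lra.
have kl : 4 * kappa * (t / K.+1%:R) <= expR (-1).
  apply: (@le_trans _ _ (4 * kappa * (speed mu D)^-1)).
    by rewrite ler_wpM2l// mulr_ge0// ltW.
  rewrite ler_pdivrMr// expRN -ler_pdivrMl ?invr_gt0// invrK /speed.
  by rewrite (_ : expR 1 * (4 * kappa)
    = 4 * expR 1 * kappa) ?lerDl ?mulr_ge0 ?(ltW D_gt0)//; ring.
apply: (@le_trans _ _ (expR (-1) ^+ K.+1)); last first.
  by rewrite -expRM_natl ler_expR mulrN mulr1 lerN2 ltW.
apply: (@le_trans _ _ ((4 * kappa * (t / K.+1%:R)) ^+ K.+1)); last first.
  by apply: lerXn2r; rewrite ?nnegrE ?expR_ge0// mulr_ge0// mulr_ge0// ltW.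
apply: le_trans (prob_fast_front_le t0 Dl).
apply: le_prob; first exact: measurable_DLA_gt.
  exact: measurable_tau_le.
move=> w /= /DLA_gt[k [sk tk]].
apply: le_trans tk; apply: tau_le.
have : (Num.trunc (speed mu D * t) < k)%N by rewrite truncn_lt_nat// ltW.
by [].
Qed.

End front_bound.

Section almost_sure_speed.
Context {R : realType} {mu D : R} {d} {T : measurableType d}
  {P : probability T R} (mu_gt0 : 0 < mu) (D_gt0 : 0 < D) (S : dla_input mu D P).

Definition too_fast (n : nat) : set T :=
  [set w | ((speed mu D * n.+1%:R)%:E < DLA S w n.+1%:R)%E].

Lemma sum_prob_too_fast : (\sum_(n <oo) P (too_fast n) < +oo)%E.
Proof.
pose q := expR (- speed mu D).
have q0 : 0 < q by exact: expR_gt0.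
have q1 : q < 1 by rewrite -expR0 ltr_expR oppr_lt0 speed_gt0.
have Pq n : (P (too_fast n) <= (q ^+ n)%:E)%E.
  rewrite probE; last exact: measurable_DLA_gt.
  rewrite lee_fin; apply: (le_trans (prob_DLA_le mu_gt0 D_gt0 S _));
    first by rewrite ltr0n.
  rewrite (_ : - (speed mu D * n.+1%:R) = n.+1%:R * - (speed mu D)); last ring.
  by rewrite expRM_natl -/q exprS ler_piMl ?exprn_ge0 ?ltW.
apply: (@le_lt_trans _ _ ((1 - q)^-1)%:E); last by rewrite ltry.
apply: lime_le; first exact: is_cvg_nneseries.
apply: nearW => n; apply: (@le_trans _ _ (\sum_(0 <= i < n) (q ^+ i)%:E)%E).
  by apply: lee_sum => i _; exact: Pq.
rewrite sumEFin lee_fin big_mkord.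
have := subrX1 q n => E.
have -> : \sum_(i < n) q ^+ i = (1 - q ^+ n) / (1 - q).
  apply/(canRL (mulfK _)); first by rewrite subr_eq0 gt_eqF.
  by rewrite mulrC -[1 - q]opprB mulNr -E opprB.
rewrite ler_pdivrMr ?subr_gt0// mulVf ?subr_eq0 ?gt_eqF//.
by rewrite gerBl exprn_ge0// ltW.
Qed.

(** Monotonicity fills the gaps between integer times at the cost of a factor
    [2] in the speed. *)
Lemma limsup_DLA_finite w : ~ lim_sup_set too_fast w ->
  (limf_esup (fun t : R => (t^-1)%:E * DLA S w t) (pinfty_nbhs R) < +oo)%E.
Proof.
move=> nw.
have [N slow] : exists N, forall n, (N <= n)%N ->
  (DLA S w n.+1%:R <= (speed mu D * n.+1%:R)%:E)%E.
  apply: contrapT => h; apply: nw => N _; apply: contrapT => h'; apply: h.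
  exists N => n Nn; rewrite leNgt; apply/negP => fast; apply: h'; exists n => //.
apply: (@le_lt_trans _ _ (2 * speed mu D)%:E); last by rewrite ltry.
apply: (@le_trans _ _ (ereal_sup ((fun t : R =>
  (t^-1)%:E * DLA S w t)%E @` [set t | N.+1%:R < t]))).
  apply: ereal_inf_lbound; exists [set t : R | N.+1%:R < t] => //.
  by exists N.+1%:R; split => //; exact: num_real.
apply: ub_ereal_sup => _ [t /= Nt <-].
have t0 : 0 < t by apply: lt_trans Nt; rewrite ltr0n.
have t1 : 1 < t by apply: le_lt_trans Nt; rewrite ler1n.
pose n := Num.trunc t.
have Nn : (N <= n)%N by apply: ltnW; rewrite truncn_ge_nat ?ltW.
have tn : t <= n.+1%:R by exact/ltW/truncnS_gt.
have nt : n%:R <= t by rewrite truncn_le ltW.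
apply: (@le_trans _ _ ((t^-1)%:E * (speed mu D * n.+1%:R)%:E)%E).
  rewrite lee_pmul2l ?lte_fin ?invr_gt0//.
  exact: le_trans (DLA_mono _ _ tn) (slow _ Nn).
rewrite -EFinM lee_fin mulrC ler_pdivrMr// -natr1.
have := speed_gt0 mu_gt0 D_gt0; set s := speed mu D => s0; nra.
Qed.

End almost_sure_speed.

Theorem theorem1 (R : realType) (mu D : R) (mu_gt0 : 0 < mu) (D_gt0 : 0 < D) :
  (forall (d : measure_display) (T : measurableType d) (P : probability T R)
      (S : dla_input mu D P),
    {ae P, forall w : T,
      (limf_esup (fun t : R => (t^-1)%:E * DLA S w t) (pinfty_nbhs R)
         < +oo)%E}) /\
  (exists C1 C2 C3 : R, [/\ 0 < C1, 0 < C2, 0 < C3 &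
    forall (d : measure_display) (T : measurableType d) (P : probability T R)
        (S : dla_input mu D P) (t : R), 0 <= t ->
      (P [set w | (C1 * t)%:E < DLA S w t]
         <= (C2 * expR (- (C3 * t)))%:E)%E]).
Proof.
split.
  move=> d T P S.
  have mF n : measurable (too_fast S n) by exact: measurable_DLA_gt.
  apply: (@negligibleS _ _ _ _ (lim_sup_set (too_fast S))).
    move=> w /= inf; apply: contrapT => nw; apply: inf.
    exact: limsup_DLA_finite nw.
  exists (lim_sup_set (too_fast S)); split => //.
    apply: bigcapT_measurable => n; apply: bigcup_measurable => k _; exact: mF.
  exact: lim_sup_set_cvg0 mF (sum_prob_too_fast mu_gt0 D_gt0 S).
have s0 := speed_gt0 mu_gt0 D_gt0.
exists (speed mu D), 1, (speed mu D); split => // d T P S t t0.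
rewrite mul1r; move: t0; rewrite le_eqVlt => /predU1P[<-|t0].
  by rewrite !mulr0 oppr0 expR0 probability_le1//; exact: measurable_DLA_gt.
rewrite probE; last exact: measurable_DLA_gt.
by rewrite lee_fin; exact: prob_DLA_le.
Qed.
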